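(* Let $(\mathfrak g,[\cdot,\cdot]_{\mathfrak g})$ be a Lie algebra and $\rho:\mathfrak g\to\mathfrak{gl}(V)$ a representation of $\mathfrak g$ on a vector space $V$; write $\mu=[\cdot,\cdot]_{\mathfrak g}$. Give $\mathrm{Hom}(\otimes^kV,\mathfrak g)$ degree $k$. Then $\big(\bigoplus_{k\ge 1}\mathrm{Hom}(\otimes^{k}V,\mathfrak g),[\![\cdot,\cdot]\!]\big)$ is a graded Lie algebra, where $$[\![\theta,\phi]\!]=(-1)^{m-1}[[\mu\boxplus\rho,\theta]_{\mathsf B},\phi]_{\mathsf B},\qquad \theta\in\mathrm{Hom}(\otimes^mV,\mathfrak g),\ \phi\in\mathrm{Hom}(\otimes^nV,\mathfrak g).$$ More precisely, for $v_1,\dots,v_{m+n}\in V$, $$\begin{aligned}[\![\theta,\phi]\!](v_1,\dots,v_{m+n})=&\sum_{k=1}^{m}\sum_{\sigma\in\mathbb S_{(k-1,n)}}(-1)^{(k-1)n+1}(-1)^{\sigma}\theta\big(v_{\sigma(1)},\dots,v_{\sigma(k-1)},\rho(\phi(v_{\sigma(k)},\dots,v_{\sigma(k+n-1)}))v_{k+n},v_{k+n+1},\dots,v_{m+n}\big)\\&+\sum_{\sigma\in\mathbb S_{(m,n)}}(-1)^{mn+1}(-1)^{\sigma}\big[\theta(v_{\sigma(1)},\dots,v_{\sigma(m)}),\phi(v_{\sigma(m+1)},\dots,v_{\sigma(m+n)})\big]_{\mathfrak g}\\&+\sum_{k=1}^{n}\sum_{\sigma\in\mathbb S_{(k-1,m)}}(-1)^{m(k+n-1)}(-1)^{\sigma}\phi\big(v_{\sigma(1)},\dots,v_{\sigma(k-1)},\rho(\theta(v_{\sigma(k)},\dots,v_{\sigma(k+m-1)}))v_{k+m},v_{k+m+1},\dots,v_{m+n}\big).\end{aligned}$$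 Moreover, the Maurer-Cartan elements of this graded Lie algebra (the $T\in\mathrm{Hom}(V,\mathfrak g)$ with $[\![T,T]\!]=0$) are precisely the embedding tensors, i.e. the linear maps $T:V\to\mathfrak g$ with $[Tu,Tv]_{\mathfrak g}=T(\rho(Tu)v)$ for all $u,v\in V$.
   Context: Vector spaces are over a field of characteristic $0$. $\mathbb S_{(i,j)}$ is the set of $(i,j)$-shuffles: permutations $\sigma$ of $\{1,\dots,i+j\}$ with $\sigma(1)<\dots<\sigma(i)$ and $\sigma(i+1)<\dots<\sigma(i+j)$; $(-1)^\sigma$ is the sign of $\sigma$. Balavoine bracket: for a vector space $E$ let $C^n(E,E)=\mathrm{Hom}(\otimes^{n+1}E,E)$, $n\ge 0$. For $P\in C^p(E,E)$, $Q\in C^q(E,E)$ put $[P,Q]_{\mathsf B}=P\bar\circ Q-(-1)^{pq}Q\bar\circ P$, where $P\bar\circ Q=\sum_{k=1}^{p+1}P\circ_kQ$ and $$(P\circ_kQ)(x_1,\dots,x_{p+q+1})=\sum_{\sigma\in\mathbb S_{(k-1,q)}}(-1)^{(k-1)q}(-1)^\sigma P\big(x_{\sigma(1)},\dots,x_{\sigma(k-1)},Q(x_{\sigma(k)},\dots,x_{\sigma(k+q-1)},x_{k+q}),x_{k+q+1},\dots,x_{p+q+1}\big).$$ This makes $C^\bullet(E,E)$ a graded Lie algebra. Here $E=\mathfrak g\oplus V$. A map $f\in\mathrm{Hom}(\otimes^kV,\mathfrak g)$ is regarded as the element of $C^{k-1}(\mathfrak g\oplus V,\mathfrak g\oplus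 V)$ given by $(x_1,v_1)\otimes\cdots\otimes(x_k,v_k)\mapsto(f(v_1,\dots,v_k),0)$. The element $\mu\boxplus\rho\in C^1(\mathfrak g\oplus V,\mathfrak g\oplus V)$ is $(\mu\boxplus\rho)((x,u),(y,v))=([x,y]_{\mathfrak g},\rho(x)v)$. *)

(* Defs.v *)
From HB Require Import structures.
From mathcomp Require Import all_boot all_order all_fingroup all_algebra.
From mathcomp Require Import boolp functions.
From mathcomp Require Import zify.

Set Implicit Arguments.
Unset Strict Implicit.
Unset Printing Implicit Defensive.

Import GRing.Theory.
Local Open Scope ring_scope.

HB.mixin Record Lmodule_isLieAlgebra (F : fieldType) g
    of GRing.Lmodule F g := {
  lieb : g -> g -> g;
  lieb_linearl : forall y, linear (lieb^~ y);
  lieb_linearr : forall x, linear (lieb x);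
  liebb : forall x, lieb x x = 0;
  lieb_jacobi : forall x y z,
    lieb x (lieb y z) + lieb y (lieb z x) + lieb z (lieb x y) = 0
}.

#[short(type="lieAlgType")]
HB.structure Definition LieAlgebra (F : fieldType) :=
  { g of Lmodule_isLieAlgebra F g & GRing.Lmodule F g }.

Record lieRep (F : fieldType) (g : lieAlgType F) (V : lmodType F) := LieRep {
  lieRep_fun :> g -> {linear V -> V};
  lieRep_linear : forall v, linear (fun x => lieRep_fun x v);
  lieRep_lieb : forall x y v, lieRep_fun (lieb x y) v =
    lieRep_fun x (lieRep_fun y v) - lieRep_fun y (lieRep_fun x v)
}.

(** [multilin n V W] stands for Hom(V^{(x) n}, W), through the universal
    property of the tensor power; [V] may be infinite dimensional. *)
Definition multilinear (F : fieldType) n (V W : lmodType F)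
    (f : ('I_n -> V) -> W) : Prop :=
  forall (i : 'I_n) (v : 'I_n -> V), linear (fun x => f [eta v with i |-> x]).

Definition multilinear_pred (F : fieldType) n (V W : lmodType F) :
    {pred ('I_n -> V) -> W} := fun f => `[< multilinear f >].

Record multilin (F : fieldType) n (V W : lmodType F) := MultiLin {
  multilin_fun :> ('I_n -> V) -> W;
  multilin_funP : multilin_fun \in @multilinear_pred F n V W
}.

Section MultilinLmodule.
Variables (F : fieldType) (n : nat) (V W : lmodType F).

Lemma multilinear_submod_closed : submod_closed (@multilinear_pred F n V W).
Proof.
split=> [|a f g /asboolP hf /asboolP hg]; apply/asboolP => i v b x y.
  by rewrite -[LHS]/(0 : W) -[RHS]/(b *: (0 : W) + 0) scaler0 addr0.
transitivity (a *: f [eta v with i |-> b *: x + y]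
              + g [eta v with i |-> b *: x + y]) => //.
rewrite (hf i v b x y) (hg i v b x y).
rewrite -[RHS]/(b *: (a *: f [eta v with i |-> x] + g [eta v with i |-> x])
                + (a *: f [eta v with i |-> y] + g [eta v with i |-> y])).
by rewrite !scalerDr !scalerA (mulrC a b) addrACA.
Qed.

HB.instance Definition _ := [isSub for @multilin_fun F n V W].
HB.instance Definition _ := [Choice of multilin n V W by <:].
HB.instance Definition _ :=
  GRing.isSubmodClosed.Build _ _ _ multilinear_submod_closed.
HB.instance Definition _ := [SubChoice_isSubLmodule of multilin n V W by <:].

Definition to_multilin (f : ('I_n -> V) -> W) (hf : multilinear f) :
  multilin n V W := MultiLin (asboolT hf).

Lemma multilinP (f : multilin n V W) : multilinear f.
Proof. exact/asboolP/multilin_funP. Qed.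

Lemma multilin_eqP (f g : multilin n V W) : f =1 g -> f = g.
Proof. by move=> fg; apply/val_inj/funext. Qed.

Lemma multilin_comp_linear (U : lmodType F) (f : multilin n V W)
    (a : U -> 'I_n -> V) (j : 'I_n) :
  linear (a^~ j) -> (forall l c d, l != j -> a c l = a d l) ->
  linear (fun c => f (a c)).
Proof.
move=> aj al b c d.
have E e : a e = [eta a 0 with j |-> a e j].
  by apply/funext => l /=; case: eqVneq => [->//|]; exact: al.
have e : a (b *: c + d) j = b *: a c j + a d j by exact: aj.
have := multilinP f j (a 0) b (a c j) (a d j).
by rewrite -e -!E.
Qed.

End MultilinLmodule.

Arguments multilin_comp_linear {F n V W U} f a j.

(** Hom(V^{(x) 1}, W) is the space of linear maps V -> W *)
Section Multilin1.
Variables (F : fieldType) (V W : lmodType F).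

Definition linear_of_multilin1_fun (f : multilin 1 V W) (v : V) : W :=
  f (fun=> v).

Lemma linear_of_multilin1_is_linear f : linear (linear_of_multilin1_fun f).
Proof. by apply: (multilin_comp_linear f (fun c _ => c) ord0) => // l; rewrite ord1. Qed.

HB.instance Definition _ f :=
  GRing.isLinear.Build F V W *:%R (linear_of_multilin1_fun f)
    (linear_of_multilin1_is_linear f).

Definition linear_of_multilin1 (f : multilin 1 V W) : {linear V -> W} :=
  linear_of_multilin1_fun f.

Lemma multilin1_is_multilinear (f : {linear V -> W}) :
  multilinear (fun v : 'I_1 -> V => f (v ord0)).
Proof. by move=> i v a x y; rewrite (ord1 i) /= linearP. Qed.

Definition multilin1_of_linear (f : {linear V -> W}) : multilin 1 V W :=
  to_multilin (multilin1_is_multilinear f).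

Lemma linear_of_multilin1K : cancel linear_of_multilin1 multilin1_of_linear.
Proof.
move=> f; apply: multilin_eqP => v.
rewrite -[LHS]/(f (fun=> v ord0)); congr (multilin_fun f _).
by apply/funext => i; rewrite (ord1 i).
Qed.

Lemma multilin1_of_linearK (f : {linear V -> W}) :
  linear_of_multilin1 (multilin1_of_linear f) =1 f.
Proof. by []. Qed.

End Multilin1.

Definition degcast (L : nat -> Type) m n (e : m = n) (x : L m) : L n :=
  ecast k (L k) e x.

(** [L k] is the component of degree [k]; in characteristic 0 the identities
    below imply [x, x] = 0 for x even and [x, [x, x]] = 0 for x odd. *)
Record graded_lie_algebra (F : fieldType) (L : nat -> lmodType F)
    (br : forall m n, L m -> L n -> L (m + n)%N) : Prop := {
  graded_lie_linearl : forall m n (y : L n), linear (fun x : L m => br m n x y);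
  graded_lie_linearr : forall m n (x : L m), linear (br m n x);
  graded_lie_skew : forall m n (x : L m) (y : L n),
    br m n x y =
    - ((-1) ^+ (m * n) *:
        degcast (L := fun k => L k) (addnC n m) (br n m y x));
  graded_lie_jacobi : forall m n p (x : L m) (y : L n) (z : L p),
    br m (n + p)%N x (br n p y z) =
    degcast (L := fun k => L k) (esym (addnA m n p))
      (br (m + n)%N p (br m n x y) z)
    + (-1) ^+ (m * n) *:
      degcast (L := fun k => L k) (addnCA n m p)
        (br n (m + p)%N y (br m p x z))
}.

Definition maurer_cartan (F : fieldType) (L : nat -> lmodType F)
    (br : forall m n, L m -> L n -> L (m + n)%N) (x : L 1%N) : Prop :=
  br 1%N 1%N x x = 0.

(** Indices start at 0: a shuffle permutes {0, ..., i + j - 1}. *)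
Definition shuffles i j : {set 'S_(i + j)} :=
  [set s : 'S_(i + j) |
    [forall a : 'I_(i + j), forall b : 'I_(i + j),
      (a < b)%N && ((b < i)%N || (i <= a)%N) ==> (s a < s b)%N]].

Definition perm_nat n (s : 'S_n) (a : nat) : nat :=
  oapp (fun i : 'I_n => s i : nat) a (insub a).

Lemma perm_nat_id n (s : 'S_n) a : (n <= a)%N -> perm_nat s a = a.
Proof. by move=> na; rewrite /perm_nat insubN // -leqNgt. Qed.

Lemma perm_nat_lt n (s : 'S_n) a : (a < n)%N -> (perm_nat s a < n)%N.
Proof. by move=> an; rewrite /perm_nat; case: insubP => [i _ _ /=|/negP//]. Qed.

Lemma perm_nat_lt_le n m (s : 'S_n) a :
  (n <= m)%N -> (a < m)%N -> (perm_nat s a < m)%N.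
Proof.
move=> nm am; case: (ltnP a n) => [/(perm_nat_lt s)/leq_trans->//|].
by move=> /(perm_nat_id s) ->.
Qed.

Lemma perm_natK n (s : 'S_n) : cancel (perm_nat s) (perm_nat s^-1%g).
Proof.
move=> a; case: (ltnP a n) => an; last by rewrite !perm_nat_id.
rewrite /perm_nat; case: insubP => [i _ <-|/negP//] /=.
by rewrite valK /= permK.
Qed.

Section Balavoine.
Variables (F : fieldType) (E : lmodType F).

(** C^n(E, E) = Hom(E^{(x) n + 1}, E) *)
Local Notation C n := (multilin n.+1 E E).

(** [k] is one less than in the usual formula, arguments being numbered from 0:
    slots 0, ..., k - 1 of [P] receive x_(s 0), ..., x_(s (k - 1)), and [Q] is
    applied to x_(s k), ..., x_(s (k + q - 1)), x_(k + q), the last index being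
    fixed by [perm_nat s]. All arguments of [inord] are < p + q + 1. *)
Definition balavoine_circ_fun p q (P : C p) (Q : C q) (k : 'I_p.+1)
    (x : 'I_(p + q).+1 -> E) : E :=
  \sum_(s in shuffles k q) ((-1) ^+ (k * q) * (-1) ^+ s) *:
    P (fun j : 'I_p.+1 =>
         if (j < k)%N then x (inord (perm_nat s j))
         else if j == k then
           Q (fun l : 'I_q.+1 => x (inord (perm_nat s (k + l))))
         else x (inord (j + q))).

Lemma balavoine_circ_multilinear p q (P : C p) (Q : C q) (k : 'I_p.+1) :
  multilinear (balavoine_circ_fun P Q k).
Proof.
move=> i v a y z; rewrite /balavoine_circ_fun scaler_sumr -big_split /=.
apply: eq_bigr => s _; move: (_ * _) => e.
rewrite scalerA (mulrC a) -scalerA -scalerDr.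
congr (_ *: _) => {e}; have kp := ltn_ord k.
pose t := perm_nat s^-1%g i.
have tE : perm_nat s t = i by rewrite -[s]invgK perm_natK.
have tlt : (t < (p + q).+1)%N by apply: perm_nat_lt_le => //; lia.
pose X c u := [eta v with i |-> c] (inord (perm_nat s u)) : E.
have Xt c : X c t = c by rewrite /X tE /= inord_val eqxx.
have Xn c d u : (u < (p + q).+1)%N -> u != t -> X c u = X d u.
  move=> up ut; rewrite /X /=; case: eqP => // /(congr1 val) /=.
  rewrite inordK; last by apply: perm_nat_lt_le => //; lia.
  by move=> e; case/eqP: ut; rewrite /t -e perm_natK.
pose A c (j : 'I_p.+1) :=
  if (j < k)%N then X c j
  else if j == k then Q (fun l : 'I_q.+1 => X c (k + l)%N)
  else X c (j + q)%N.
have AE c : A c = fun j : 'I_p.+1 =>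
    if (j < k)%N then X c j
    else if j == k then Q (fun l : 'I_q.+1 => X c (k + l)%N)
    else [eta v with i |-> c] (inord (j + q)).
  apply/funext => j; rewrite /A; case: ltnP => // kj; case: eqVneq => // jk.
  by rewrite /X perm_nat_id //; move: jk; rewrite -val_eqE /=; lia.
suff: P (A (a *: y + z)) = a *: P (A y) + P (A z) by rewrite !AE.
pose j0 := if (t < k)%N then t else if (t <= k + q)%N then k : nat
           else (t - q)%N.
have j0p : (j0 < p.+1)%N by rewrite /j0; do 2?case: ifP; lia.
apply: (multilin_comp_linear P A (Ordinal j0p)) => [|j c d].
- rewrite /A /=; rewrite -val_eqE /= /j0.
  case: (ltnP t k) => tk; first by rewrite tk => b c d; rewrite !Xt.
  case: (leqP t (k + q)) => tkq.
  + rewrite ltnn eqxx.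
    have lq : (t - k < q.+1)%N by lia.
    apply: (multilin_comp_linear Q (fun c (l : 'I_q.+1) => X c (k + l)%N)
              (Ordinal lq)) => [b c d|l c d].
      by rewrite /= subnKC // !Xt.
    by rewrite -val_eqE /= => ne; have := ltn_ord l => ?; apply: Xn; lia.
  + have -> : (t - q < k)%N = false by lia.
    have -> : (t - q == k)%N = false by lia.
    have e : (t - q + q)%N = t by lia.
    by move=> b c d; rewrite e !Xt.
- rewrite -val_eqE /= /j0 /A -val_eqE /= => ne.
  have := ltn_ord j => jp.
  case: (ltnP j k) => jk.
    by apply: Xn; first lia; move: ne; do 2?case: ifP; lia.
  case: eqVneq => jk'.
    congr (Q _); apply/funext => l; have := ltn_ord l => lq.
    by apply: Xn; first lia; move: ne; do 2?case: ifP; lia.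
  by apply: Xn; first lia; move: ne; do 2?case: ifP; lia.
Qed.

Definition balavoine_circ p q (P : C p) (Q : C q) (k : 'I_p.+1) : C (p + q) :=
  to_multilin (balavoine_circ_multilinear P Q k).

Definition balavoine_comp p q (P : C p) (Q : C q) : C (p + q) :=
  \sum_(k < p.+1) balavoine_circ P Q k.

Definition balavoine p q (P : C p) (Q : C q) : C (p + q) :=
  balavoine_comp P Q
  - (-1) ^+ (p * q) *:
    degcast (L := fun n => C n) (addnC q p) (balavoine_comp Q P).

End Balavoine.

Section DerivedBracket.
Variables (F : fieldType) (g : lieAlgType F) (V : lmodType F).

Local Notation C n := (multilin n.+1 (g * V)%type (g * V)%type).

Lemma lift_hom_multilinear m (f : multilin m.+1 V g) :
  multilinear (fun x : 'I_m.+1 -> (g * V)%type =>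
                 (f (fun i => (x i).2), 0) : (g * V)%type).
Proof.
move=> i v a x y; set A := fun c : (g * V)%type =>
  (fun j => ([eta v with i |-> c] j).2).
have fA : linear (fun c => f (A c)).
  apply: (multilin_comp_linear f A i) => [b c d|l c d li].
    by rewrite /A /= eqxx.
  by rewrite /A /= (negbTE li).
apply/eqP; rewrite xpair_eqE /= scaler0 addr0 eqxx andbT.
exact/eqP/fA.
Qed.

Definition lift_hom m (f : multilin m.+1 V g) : C m :=
  to_multilin (lift_hom_multilinear f).

Lemma mu_rho_multilinear (rho : lieRep g V) :
  multilinear (fun x : 'I_2 -> (g * V)%type =>
    (lieb (x ord0).1 (x ord_max).1, rho (x ord0).1 (x ord_max).2)
      : (g * V)%type).
Proof.
move=> i v a x y.
case: (unliftP ord0 i) => [j ->|->] /=; last first.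
  apply/eqP; rewrite xpair_eqE /=.
  by rewrite lieb_linearl lieRep_linear !eqxx.
rewrite (ord1 j) -!val_eqE /=.
by apply/eqP; rewrite xpair_eqE /= lieb_linearr linearP !eqxx.
Qed.

Definition mu_rho (rho : lieRep g V) : C 1 :=
  to_multilin (mu_rho_multilinear rho).

Lemma derived_degree m n : (1 + m + n = m + n.+1)%N.
Proof. by rewrite addnS. Qed.

(** (-1)^(m - 1) [[mu + rho, theta], phi] for theta in Hom(V^{(x) m}, g) and
    phi in Hom(V^{(x) n}, g), with m and n shifted by one *)
Definition derived_cochain (rho : lieRep g V) m n
    (theta : multilin m.+1 V g) (phi : multilin n.+1 V g) : C (m + n.+1) :=
  degcast (L := fun k => C k) (derived_degree m n)
    ((-1) ^+ m *:
      balavoine (balavoine (mu_rho rho) (lift_hom theta)) (lift_hom phi)).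

Lemma restr_hom_multilinear m (P : C m) :
  multilinear (fun v : 'I_m.+1 -> V => (P (fun i => (0, v i))).1).
Proof.
move=> i v a x y; set A := fun c : V =>
  (fun j => (0, [eta v with i |-> c] j)) : 'I_m.+1 -> (g * V)%type.
have PA : linear (fun c => P (A c)).
  apply: (multilin_comp_linear P A i) => [b c d|l c d li].
    by rewrite /A /= eqxx; apply/eqP; rewrite xpair_eqE /= scaler0 addr0 !eqxx.
  by rewrite /A /= (negbTE li).
exact: (congr1 fst (PA a x y)).
Qed.

Definition restr_hom m (P : C m) : multilin m.+1 V g :=
  to_multilin (restr_hom_multilinear P).

Lemma lift_homK m : cancel (@lift_hom m) (@restr_hom m).
Proof. by move=> f; exact: multilin_eqP. Qed.

Definition derived_bracket (rho : lieRep g V) m n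
    (theta : multilin m.+1 V g) (phi : multilin n.+1 V g) :
    multilin (m.+1 + n.+1) V g :=
  restr_hom (derived_cochain rho theta phi).

(** (+)_(k >= 1) Hom(V^{(x) k}, g), with zero component in degree 0 *)
Definition graded_hom (k : nat) : lmodType F :=
  if k is k'.+1 then multilin k'.+1 V g else 'rV[F]_0.

Definition graded_derived_bracket (rho : lieRep g V) (m n : nat) :
    graded_hom m -> graded_hom n -> graded_hom (m + n) :=
  match m, n with
  | m'.+1, n'.+1 => @derived_bracket rho m' n'
  | _, _ => fun _ _ => 0
  end.

Definition embedding_tensor (rho : lieRep g V) (T : {linear V -> g}) : Prop :=
  forall u v, lieb (T u) (T v) = T (rho (T u) v).

End DerivedBracket.

(* Main.v *)
(** A cochain is encoded as a function on words.  Writing [Q_x] for [Q] with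
    its first argument set to [x], the shuffle sums defining the Balavoine
    product [P o Q] collapse to the recursion
    [(P o Q)_x = (-1)^q P_x o Q + P o Q_x], and the graded pre-Lie identity of
    [o] follows by induction on the word; hence the Jacobi identity of the
    Balavoine bracket.  As [mu + rho] squares to zero and the cochains lifted
    from Hom(V^{(x) k}, g) commute, the derived bracket is a graded Lie bracket.
    The same recursion evaluates [[mu + rho, theta], phi] on arbitrary words of
    g + V, and the recursive description of shuffles (0 is the image of the first
    element of one of the two blocks) turns the result into the explicit
    formula. *)
Require Import Defs.
From HB Require Import structures.
From mathcomp Require Import all_boot all_order all_fingroup all_algebra.
From mathcomp Require Import boolp functions.
From mathcomp Require Import zify.

Set Implicit Arguments.
Unset Strict Implicit.
Unset Printing Implicit Defensive.

Import GRing.Theory.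
Local Open Scope ring_scope.

(** Multilinear maps of degrees such as [m + n.+1] and [m.+1 + n] have different types, so the
    graded identities are only stated up to [degcast]. Functions on words have one type in all
    degrees: the casts disappear, arity becomes the vanishing condition [word_supp], and fixing a
    first argument is a mere [cons]. The shuffle sums collapse because the Balavoine product never
    permutes the last argument of the inserted cochain $Q$: when a word is read from the left, the
    slot of $Q$ is reached exactly when $Q$ has absorbed its last letter. The price is that fixing
    arguments leads down to arity 0, that is degree $-1$, which lies outside the graded Lie algebra;
    the pre-Lie identity has to cover it. Characteristic 0 enters through the invertibility of 2:
    $[\mu,[\mu,P]]=0$ is deduced from $2[\mu,[\mu,P]]=0$, and $[\![T,T]\!]$ is twice the defect of
    the embedding tensor equation. *)

(** * Additive identities in abelian groups, by reflection *)

Inductive zmodExp :=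
  | ZVar of nat | ZZero | ZOpp of zmodExp | ZAdd of zmodExp & zmodExp.

Section ZmodNormalization.
Variable M : zmodType.

Fixpoint zmod_eval (env : seq M) e : M :=
  match e with
  | ZVar i => env`_i
  | ZZero => 0
  | ZOpp e => - zmod_eval env e
  | ZAdd e f => zmod_eval env e + zmod_eval env f
  end.

Fixpoint zmod_coef e (i : nat) : int :=
  match e with
  | ZVar j => (i == j)%:Z
  | ZZero => 0
  | ZOpp e => - zmod_coef e i
  | ZAdd e f => zmod_coef e i + zmod_coef f i
  end.

Lemma zmod_evalE env e :
  zmod_eval env e = \sum_(i < size env) env`_i *~ zmod_coef e i.
Proof.
elim: e => [j||e IH|e IHe f IHf] /=.
- have [js|js] := ltnP j (size env).
    rewrite (bigD1 (Ordinal js)) //= eqxx big1 ?addr0 // => i.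
    by rewrite -val_eqE /= => /negbTE->.
  rewrite nth_default // big1 // => i _.
  by have := ltn_ord i; case: eqVneq => // ->; rewrite ltnNge js.
- by rewrite big1 // => i _; rewrite mulr0z.
- by rewrite IH -sumrN; apply: eq_bigr => i _; rewrite mulrNz.
- by rewrite IHe IHf -big_split; apply: eq_bigr => i _; rewrite mulrzDr.
Qed.

Lemma zmod_eq env e f :
  all (fun i => zmod_coef e i == zmod_coef f i) (iota 0 (size env)) ->
  zmod_eval env e = zmod_eval env f.
Proof.
move/allP=> ef; rewrite !zmod_evalE; apply: eq_bigr => i _.
by rewrite (eqP (ef i _)) // mem_iota ltn_ord.
Qed.

End ZmodNormalization.

(* Atoms are compared up to conversion, since the algebraic structures of
   equal terms may have been inferred along different paths. *)
Ltac zmod_index x env :=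
  match env with
  | ?y :: _ => let _ := match goal with _ => unify x y end in constr:(0%N)
  | _ :: ?l => let n := zmod_index x l in constr:(n.+1)
  end.

Ltac zmod_atom env x :=
  match env with
  | _ => let _ := zmod_index x env in env
  | _ => constr:(x :: env)
  end.

Ltac zmod_atoms env e :=
  lazymatch e with
  | 0 => env
  | - ?a => zmod_atoms env a
  | ?a + ?b => let env := zmod_atoms env a in zmod_atoms env b
  | _ => zmod_atom env e
  end.

Ltac zmod_reify env e :=
  lazymatch e with
  | 0 => constr:(ZZero)
  | - ?a => let a := zmod_reify env a in constr:(ZOpp a)
  | ?a + ?b => let a := zmod_reify env a in let b := zmod_reify env b in
               constr:(ZAdd a b)
  | _ => let n := zmod_index e env in constr:(ZVar n)
  end.

Ltac zmod :=
  lazymatch goal with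
  | |- @eq ?T ?a ?b =>
    let env := zmod_atoms (@nil T) a in
    let env := zmod_atoms env b in
    let ea := zmod_reify env a in
    let eb := zmod_reify env b in
    refine (@zmod_eq _ env ea eb _); vm_compute; reflexivity
  end.

(** Once all signs depend only on parities of degrees, a case analysis on these parities turns them
    into 1 or $-1$, and [zmod] decides what remains. *)
Ltac odd_signs :=
  repeat match goal with
  | |- context [@GRing.exp ?R (- 1) ?n] =>
    lazymatch n with
    | nat_of_bool _ => fail
    | _ => rewrite -(@signr_odd R n)
    end
  end; rewrite /= ?(oddD, oddM) /=.

Ltac simpl_signs := rewrite /= ?(expr0, expr1, scale1r, scaleN1r).

Lemma linear_map0 (F : fieldType) (U W : lmodType F) (f : U -> W) :
  linear f -> f 0 = 0.
Proof.
by move=> lf; have := lf (-1) 0 0; rewrite !scaler0 !addr0 scaleN1r => {1}->;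
  rewrite addNr.
Qed.

(** * Cochains as functions on words *)

Section Words.
Variables (F : fieldType) (E : lmodType F).

Definition contract (W : Type) (x : E) (f : seq E -> W) : seq E -> W :=
  fun w => f (x :: w).

Definition word_multilinear (W : lmodType F) (f : seq E -> W) :=
  forall u w, linear (fun x => f (u ++ x :: w)).

Definition word_supp (W : lmodType F) n (f : seq E -> W) :=
  forall w, size w != n -> f w = 0.

(** [P o Q] for [Q] of arity [a]. Moving a letter [x] to the left of [Q] costs the
    sign (-1)^(a - 1), the degree of [Q]; otherwise [Q] absorbs [x], which lowers
    its arity by one. *)
Fixpoint insertion (W : lmodType F) a (Q : seq E -> E) (P : seq E -> W)
    (w : seq E) {struct w} : W :=
  match a, w with
  | 0%N, _ => P (Q [::] :: w)
  | _.+1, [::] => 0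
  | a'.+1, x :: w' =>
    (-1) ^+ a' *: insertion a Q (contract x P) w'
    + insertion a' (contract x Q) P w'
  end.

Lemma scaler_swap (W : lmodType F) (a b : F) (x : W) :
  a *: (b *: x) = b *: (a *: x).
Proof. by rewrite !scalerA mulrC. Qed.

Lemma contract_linear (W : lmodType F) x : linear (@contract W x).
Proof. by []. Qed.

Section Contract.
Variable W : lmodType F.
Implicit Types P : seq E -> W.

Lemma contract_multilinear P :
  word_multilinear P -> linear (fun x => contract x P).
Proof. by move=> lP c x y; apply/funext => w; exact: (lP [::] w). Qed.

Lemma word_multilinear_contract P x :
  word_multilinear P -> word_multilinear (contract x P).
Proof. by move=> lP u w; exact: (lP (x :: u) w). Qed.

Lemma word_supp_contract n P x : word_supp n.+1 P -> word_supp n (contract x P).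
Proof. by move=> sP w wn; apply: sP. Qed.

Lemma word_supp0_contract P x : word_supp 0 P -> contract x P = 0.
Proof. by move=> sP; apply/funext => w; apply: sP. Qed.

End Contract.

Section Insertion.
Variable W : lmodType F.
Implicit Types (P : seq E -> W) (Q : seq E -> E).

Lemma insertion0 Q P : insertion 0 Q P = contract (Q [::]) P.
Proof. by apply/funext => -[]. Qed.

Lemma contract_insertion a Q P x :
  contract x (insertion a.+1 Q P) =
  (-1) ^+ a *: insertion a.+1 Q (contract x P) + insertion a (contract x Q) P.
Proof. by []. Qed.

Lemma insertion_linearr a Q : linear (@insertion W a Q).
Proof.
move=> c P R; apply/funext => w.
elim: w a Q P R => [|x w IH] [|a] Q P R //=.
  by rewrite -[RHS]/(c *: (0 : W) + 0) scaler0 addr0.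
rewrite -[RHS]/(c *: ((-1) ^+ a *: insertion a.+1 Q (contract x P) w
    + insertion a (contract x Q) P w)
  + ((-1) ^+ a *: insertion a.+1 Q (contract x R) w
    + insertion a (contract x Q) R w)).
rewrite contract_linear !IH.
rewrite -![(c *: _ + _) w]/(c *: _ w + _ w).
rewrite !scalerDr !(scaler_swap c); zmod.
Qed.

Lemma insertion_linearl a P :
  word_multilinear P -> linear (fun Q => insertion a Q P).
Proof.
move=> lP c Q R; apply/funext => w.
elim: w a P lP Q R => [|x w IH] [|a] P lP Q R.
- exact: (lP [::]).
- by rewrite -[RHS]/(c *: (0 : W) + 0) scaler0 addr0.
- exact: (lP [::] (x :: w)).
rewrite -[RHS]/(c *: ((-1) ^+ a *: insertion a.+1 Q (contract x P) w
    + insertion a (contract x Q) P w)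
  + ((-1) ^+ a *: insertion a.+1 R (contract x P) w
    + insertion a (contract x R) P w)).
rewrite /= contract_linear !IH //; last exact: word_multilinear_contract.
rewrite -![(c *: _ + _) w]/(c *: _ w + _ w).
rewrite !scalerDr !(scaler_swap c); zmod.
Qed.

Lemma insertionDr a Q P R :
  insertion a Q (P + R) = insertion a Q P + insertion a Q R.
Proof. by have := insertion_linearr a Q 1 P R; rewrite !scale1r. Qed.

Lemma insertionr0 a Q : insertion a Q (0 : seq E -> W) = 0.
Proof. exact: linear_map0 (@insertion_linearr a Q). Qed.

Lemma insertionZr a Q c P : insertion a Q (c *: P) = c *: insertion a Q P.
Proof. by have := insertion_linearr a Q c P 0; rewrite insertionr0 !addr0. Qed.

Lemma insertionDl a Q R P : word_multilinear P ->
  insertion a (Q + R) P = insertion a Q P + insertion a R P.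
Proof. by move=> lP; have := insertion_linearl a lP 1 Q R; rewrite !scale1r. Qed.

Lemma insertion0l a P : word_multilinear P -> insertion a 0 P = 0.
Proof. by move=> lP; exact: linear_map0 (insertion_linearl a lP). Qed.

Lemma insertionZl a c Q P : word_multilinear P ->
  insertion a (c *: Q) P = c *: insertion a Q P.
Proof.
by move=> lP; have := insertion_linearl a lP c Q 0; rewrite insertion0l // !addr0.
Qed.

Lemma insertion_supp0 a Q P : word_supp 0 P -> insertion a Q P = 0.
Proof.
move=> sP; apply/funext => w; elim: w a Q => [|x w IH] [|a] Q //=.
- by apply: sP.
- by apply: sP.
by rewrite word_supp0_contract // insertionr0 scaler0 add0r IH.
Qed.

Lemma word_supp_insertion a b Q P :
  word_supp a Q -> word_supp b.+1 P -> word_supp (a + b) (insertion a Q P).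
Proof.
move=> sQ sP w; elim: w a b Q P sQ sP => [|x w IH] [|a] b Q P sQ sP //= wn.
- by apply: sP => /=; lia.
- by apply: sP => /=; lia.
rewrite (IH a b) ?addr0; last 3 first.
- exact: word_supp_contract.
- by [].
- lia.
case: b sP wn => [|b] sP wn; last first.
  rewrite (IH a.+1 b) ?scaler0 //; first exact: word_supp_contract.
  lia.
rewrite insertion_supp0 ?scaler0 //; exact: word_supp_contract.
Qed.

Lemma word_multilinear_insertion a Q P :
  word_multilinear Q -> word_multilinear P -> word_multilinear (insertion a Q P).
Proof.
move=> lQ lP u; elim: u a Q P lQ lP => [|z u IH] [|a] Q P lQ lP w c x y.
- exact: (lP [:: Q [::]]).
- rewrite [LHS]/= !contract_multilinear // insertion_linearr insertion_linearl //.
  rewrite -![(c *: _ + _) w]/(c *: _ w + _ w) /=.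
  rewrite !scalerDr !(scaler_swap c); zmod.
- exact: (lP (Q [::] :: z :: u)).
rewrite [LHS]/= !IH //; try exact: word_multilinear_contract.
rewrite /= !scalerDr !(scaler_swap c); zmod.
Qed.

(** This is what the free codomain [W] is for: it is applied below to [snd] and to
    $y\mapsto\mu(x,y)$. *)
Lemma insertion_comp a Q P (W' : lmodType F) (L : W -> W') : linear L ->
  insertion a Q (fun w => L (P w)) = fun w => L (insertion a Q P w).
Proof.
move=> lL; apply/funext => w; elim: w a Q P => [|x w IH] [|a] Q P //=.
  by rewrite linear_map0.
by rewrite lL -(IH a.+1 Q (contract x P)) -(IH a (contract x Q) P).
Qed.

End Insertion.

(** [P] amounts to the single letter [P [::]] and has no slot for [Q], so [insertion b.+1 Q P]
    vanishes. What remains is the recursion [contract_insertion] at that letter. *)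
Lemma pre_lie_arity0 (W : lmodType F) b (P Q : seq E -> E) (R : seq E -> W) :
  word_multilinear R -> word_supp 0 P ->
  insertion b.+1 Q (insertion 0 P R) - insertion b (insertion b.+1 Q P) R =
  (-1) ^+ b *:
    (insertion 0 P (insertion b.+1 Q R) - insertion b (insertion 0 P Q) R).
Proof.
move=> lR sP; rewrite !insertion0 (insertion_supp0 _ _ sP) insertion0l // subr0.
by rewrite contract_insertion addrK scalerA -expr2 sqrr_sign scale1r.
Qed.

(* Arity 0 (degree -1) is the base of the induction; [a.+1 * b.+1] has the parity
   of the product of the degrees [(a - 1) * (b - 1)] even then. *)
Lemma pre_lie (W : lmodType F) a b (P Q : seq E -> E) (R : seq E -> W) :
  (0 < a + b)%N -> word_multilinear R -> word_supp a P -> word_supp b Q ->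
  insertion b Q (insertion a P R) - insertion (a + b).-1 (insertion b Q P) R =
  (-1) ^+ (a.+1 * b.+1) *:
    (insertion a P (insertion b Q R) - insertion (a + b).-1 (insertion a P Q) R).
Proof.
case: a => [|a] ab lR sP sQ.
  case: b ab sQ => // b _ sQ.
  by rewrite pre_lie_arity0 // mul1n; odd_signs; rewrite negbK.
case: b ab sQ => [|b] ab sQ.
  rewrite addn0 muln1 /= (pre_lie_arity0 _ _ lR sQ) scalerA.
  by rewrite -exprD; odd_signs; case: (odd a); simpl_signs.
apply/funext => w {ab}.
elim: w a b P Q R lR sP sQ => [|x w IH] a b P Q R lR sP sQ.
  by rewrite addnS /= -[RHS]/(_ *: (0 - 0)) -[LHS]/(0 - 0) subrr scaler0.
have eD (f h : seq E -> W) : (f + h) w = f w + h w by [].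
have eZ c (f : seq E -> W) : (c *: f) w = c *: f w by [].
have eN (f : seq E -> W) : (- f) w = - f w by [].
have lRx : word_multilinear (contract x R) by exact: word_multilinear_contract.
have sPx : word_supp a (contract x P) by exact: word_supp_contract.
have sQx : word_supp b (contract x Q) by exact: word_supp_contract.
(* The letter [x] goes to [R], to [P] or to [Q]; each case is an instance of the identity on the
   shorter word [w]. If [P] or [Q] had arity 1, it drops to arity 0, out of reach of [IH], and
   [pre_lie_arity0] takes over. *)
have IHR := IH a b P Q (contract x R) lRx sP sQ.
have IHP : (insertion b.+1 Q (insertion a (contract x P) R)
      - insertion (a + b) (insertion b.+1 Q (contract x P)) R) w =
    ((-1) ^+ (a.+1 * b.+2) *: (insertion a (contract x P) (insertion b.+1 Q R)
      - insertion (a + b) (insertion a (contract x P) Q) R)) w.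
  case: a sP sPx IHR => [|a] sP sPx IHR.
    by rewrite pre_lie_arity0 // mul1n; odd_signs; rewrite negbK.
  by have := IH a b _ Q R lR sPx sQ; rewrite addnS.
have IHQ : (insertion b (contract x Q) (insertion a.+1 P R)
      - insertion (a + b) (insertion b (contract x Q) P) R) w =
    ((-1) ^+ (a.+2 * b.+1) *: (insertion a.+1 P (insertion b (contract x Q) R)
      - insertion (a + b) (insertion a.+1 P (contract x Q)) R)) w.
  case: b sQ sQx IHR IHP => [|b] sQ sQx IHR IHP.
    rewrite addn0 muln1 /= (pre_lie_arity0 _ _ lR sQx) scalerA.
    by rewrite -exprD; odd_signs; case: (odd a); simpl_signs.
  by have := IH a b P _ R lR sP sQx; rewrite addSn.
rewrite addSn addnS /= in IHR *.
rewrite -[LHS]/(contract x (insertion b.+1 Q (insertion a.+1 P R)) w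
  - contract x (insertion (a + b).+1 (insertion b.+1 Q P) R) w).
rewrite -[RHS]/(_ *: (contract x (insertion a.+1 P (insertion b.+1 Q R)) w
  - contract x (insertion (a + b).+1 (insertion a.+1 P Q) R) w)).
rewrite !contract_insertion !insertionDr !insertionDl //.
rewrite !insertionZr !insertionZl //.
rewrite !(eD, eZ, eN) in IHR IHP IHQ *.
(* Solving each instance for its first term leaves a linear identity whose signs depend on the
   parities of [a] and [b]. *)
move/(canRL (subrK _)): IHR => ->.
move/(canRL (subrK _)): IHP => ->.
move/(canRL (subrK _)): IHQ => ->.
odd_signs; case: (odd a); case: (odd b); simpl_signs; zmod.
Qed.

End Words.

(** * The Balavoine bracket on words and its derived bracket *)

Section WordBracket.
Variables (F : fieldType) (E : lmodType F).
Implicit Types P Q R : seq E -> E.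

Definition cochain n P := word_multilinear P /\ word_supp n.+1 P.

Definition word_bracket p q P Q : seq E -> E :=
  insertion q.+1 Q P - (-1) ^+ (p * q) *: insertion p.+1 P Q.

Lemma word_multilinear_lin c P Q :
  word_multilinear P -> word_multilinear Q -> word_multilinear (c *: P + Q).
Proof.
move=> lP lQ u w a x y.
rewrite -[LHS]/(c *: P (u ++ (a *: x + y) :: w) + Q (u ++ (a *: x + y) :: w)).
rewrite -[RHS]/(a *: (c *: P (u ++ x :: w) + Q (u ++ x :: w))
                + (c *: P (u ++ y :: w) + Q (u ++ y :: w))).
rewrite lP lQ !scalerDr (scaler_swap a); zmod.
Qed.

Lemma cochain_lin n c P Q : cochain n P -> cochain n Q -> cochain n (c *: P + Q).
Proof.
move=> [lP sP] [lQ sQ]; split; first exact: word_multilinear_lin.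
move=> w wn; rewrite -[LHS]/(c *: P w + Q w) sP // sQ // scaler0 addr0 //.
Qed.

Lemma cochain_insertion p q P Q :
  cochain p P -> cochain q Q -> cochain (p + q) (insertion q.+1 Q P).
Proof.
move=> [lP sP] [lQ sQ]; split; first exact: word_multilinear_insertion.
by rewrite -addnS addnC; apply: word_supp_insertion.
Qed.

Lemma cochain_bracket p q P Q :
  cochain p P -> cochain q Q -> cochain (p + q) (word_bracket p q P Q).
Proof.
move=> cP cQ; rewrite /word_bracket -scaleNr addrC; apply: cochain_lin.
  by rewrite addnC; apply: cochain_insertion.
exact: cochain_insertion.
Qed.

Lemma word_bracketC p q P Q :
  word_bracket p q P Q = - ((-1) ^+ (p * q) *: word_bracket q p Q P).
Proof.
rewrite /word_bracket scalerBr; odd_signs.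
by case: (odd p); case: (odd q); simpl_signs; zmod.
Qed.

Lemma word_bracket_linearl p q Q : word_multilinear Q ->
  linear (fun P => word_bracket p q P Q).
Proof.
move=> lQ c P R; rewrite /word_bracket insertion_linearr insertion_linearl //.
rewrite !scalerDr !scalerN !(scaler_swap c); zmod.
Qed.

Lemma word_bracket_linearr p q P : word_multilinear P ->
  linear (fun Q => word_bracket p q P Q).
Proof.
move=> lQ c R Q; rewrite /word_bracket insertion_linearr insertion_linearl //.
rewrite !scalerDr !scalerN !(scaler_swap c); zmod.
Qed.

Lemma word_bracketZl p q c P Q : word_multilinear Q ->
  word_bracket p q (c *: P) Q = c *: word_bracket p q P Q.
Proof.
move=> lQ; rewrite /word_bracket insertionZr insertionZl // !scalerBr.
by rewrite (scaler_swap c).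
Qed.

Lemma word_bracketZr p q c P Q : word_multilinear P ->
  word_bracket p q P (c *: Q) = c *: word_bracket p q P Q.
Proof.
move=> lQ; rewrite /word_bracket insertionZr insertionZl // !scalerBr.
by rewrite (scaler_swap c).
Qed.

Lemma word_bracket0r p q P : word_multilinear P -> word_bracket p q P 0 = 0.
Proof.
by move=> lP; exact: linear_map0 (word_bracket_linearr p q lP).
Qed.

Lemma word_bracket0l p q P : word_multilinear P -> word_bracket p q 0 P = 0.
Proof.
by move=> lP; exact: linear_map0 (word_bracket_linearl p q lP).
Qed.

Lemma insertion_assoc p q r P Q R : cochain p P -> cochain q Q -> cochain r R ->
  insertion (q + r).+1 (insertion r.+1 R Q) P =
  insertion r.+1 R (insertion q.+1 Q P)
  - (-1) ^+ (q * r) *: (insertion q.+1 Q (insertion r.+1 R P)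
                        - insertion (q + r).+1 (insertion q.+1 Q R) P).
Proof.
move=> [lP sP] [lQ sQ] [lR sR].
have := pre_lie (a := q.+1) (b := r.+1) erefl lP sQ sR.
rewrite addSn addnS /= => /(canRL (subrK _)) ->; odd_signs.
by case: (odd q); case: (odd r); simpl_signs; zmod.
Qed.

(** The commutator of a graded pre-Lie product is a Lie bracket. For each of the three outermost
    factors, [insertion_assoc] trades one of the two nested products for the other; everything then
    cancels. *)
Lemma word_jacobi p q r P Q R : cochain p P -> cochain q Q -> cochain r R ->
  word_bracket p (q + r) P (word_bracket q r Q R) =
  word_bracket (p + q) r (word_bracket p q P Q) R
  + (-1) ^+ (p * q) *: word_bracket q (p + r) Q (word_bracket p r P R).
Proof.
move=> cP cQ cR; have [[[lP _] [lQ _]] [lR _]] := (cP, cQ, cR).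
rewrite /word_bracket -!scaleNr !insertionDr !insertionZr.
rewrite !insertionDl // !insertionZl //.
rewrite (insertion_assoc cP cQ cR) (insertion_assoc cQ cP cR).
rewrite (insertion_assoc cR cP cQ).
rewrite !scaleNr !scalerDr !scalerN; odd_signs.
by case: (odd p); case: (odd q); case: (odd r);
  simpl_signs; zmod.
Qed.

Section DerivedWord.
Variable mu : seq E -> E.
Hypotheses (c_mu : cochain 1 mu) (mu2 : insertion 2 mu mu = 0).
Hypothesis nz2 : (2 : F) != 0.

Local Notation d p P := (word_bracket 1 p mu P).

(** As [mu] has odd degree and $[\mu,\mu]=0$, the Jacobi identity for $\mu,\mu,P$ reads $X=-X$ with
    $X=[\mu,[\mu,P]]$. *)
Lemma diff2 p P : cochain p P -> d p.+1 (d p P) = 0.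
Proof.
move=> cP; have := word_jacobi c_mu c_mu cP.
have -> : d 1 mu = 0.
  by rewrite /word_bracket mu2 scaler0 subr0.
rewrite word_bracket0l ?add0r; last by case: cP.
rewrite add1n; set X := word_bracket _ _ _ _; rewrite mul1n expr1 scaleN1r => XN.
have : (2 : F) *: X = 0 by rewrite scaler_nat mulr2n {1}XN addNr.
by move/eqP; rewrite scaler_eq0 (negbTE nz2) => /eqP.
Qed.

(** [m] and [n] are Balavoine degrees, one less than the arities; since the new grading is by arity,
    its signs below are $(-1)^{(m+1)(n+1)}$. *)
Definition derived_word m n P Q :=
  (-1) ^+ m *: word_bracket m.+1 n (d m P) Q.

Lemma cochain_d p P : cochain p P -> cochain p.+1 (d p P).
Proof. by move=> cP; rewrite -add1n; apply: cochain_bracket. Qed.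

(** Apply the derivation $d=[\mu,\cdot]$ to $[P,Q]=0$. *)
Lemma derived_wordC m n P Q : cochain m P -> cochain n Q ->
  word_bracket m n P Q = 0 ->
  derived_word m n P Q = - ((-1) ^+ (m.+1 * n.+1) *: derived_word n m Q P).
Proof.
move=> cP cQ PQ0; have := word_jacobi c_mu cP cQ.
rewrite PQ0 word_bracket0r; last by case: c_mu.
move/eqP; rewrite eq_sym addr_eq0 => /eqP; rewrite add1n => e.
rewrite /derived_word e add1n (word_bracketC m); odd_signs.
by case: (odd m); case: (odd n); simpl_signs; zmod.
Qed.

(** Since $d$ is a derivation of square zero, $[dP,dQ]=\pm d[dP,Q]$; the claim is then the Jacobi
    identity for $dP$, $dQ$, $R$, up to signs. *)
Lemma derived_word_jacobi m n p P Q R :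
  cochain m P -> cochain n Q -> cochain p R -> word_bracket m n P Q = 0 ->
  derived_word m (n + p).+1 P (derived_word n p Q R) =
  derived_word (m + n).+1 p (derived_word m n P Q) R
  + (-1) ^+ (m.+1 * n.+1) *:
     derived_word n (m + p).+1 Q (derived_word m p P R).
Proof.
move=> cP cQ cR PQ0.
have [cdP cdQ] := (cochain_d cP, cochain_d cQ).
have [[[[lR _] [ldP _]] [ldQ _]] [lmu _]] := (cR, cdP, cdQ, c_mu).
have dd : word_bracket m.+1 n.+1 (d m P) (d n Q) =
    (-1) ^+ m.+1 *: d (m + n).+1 (word_bracket m.+1 n (d m P) Q).
  have := word_jacobi c_mu cdP cQ; rewrite diff2 // word_bracket0l; last by case: cQ.
  rewrite add0r addSn mul1n add1n => ->.
  by rewrite scalerA -expr2 sqrr_sign scale1r.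
have := word_jacobi cdP cdQ cR.
rewrite dd word_bracketZl // !addSn !addnS => J.
rewrite /derived_word !word_bracketZr // !word_bracketZl // J.
move: (word_bracket (m + n).+2 p _ R) (word_bracket n.+1 (m + p).+1 _ _) => A B.
rewrite !scalerDr; odd_signs.
by case: (odd m); case: (odd n); case: (odd p); simpl_signs; zmod.
Qed.

End DerivedWord.
End WordBracket.

Section ShuffleSum.
Variables (F : fieldType) (E : Type) (W : lmodType F).

(** The signed sum over the (k, a)-shuffles of the first [k + a] letters of [w],
    with the extra sign (-1)^(k * a); [Psi] receives the two blocks and the
    remaining letters. *)
Fixpoint shuffle_sum k a (Psi : seq E -> seq E -> seq E -> W) (w : seq E)
    {struct w} : W :=
  if (k == 0%N) && (a == 0%N) then Psi [::] [::] w else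
  if w is x :: w' then
    (if k is k'.+1 then
       (-1) ^+ a *: shuffle_sum k' a (fun u v r => Psi (x :: u) v r) w' else 0)
    + (if a is a'.+1 then
         shuffle_sum k a' (fun u v r => Psi u (x :: v) r) w' else 0)
  else 0.

Lemma shuffle_sumE k a Psi w : shuffle_sum k a Psi w =
  if (k == 0%N) && (a == 0%N) then Psi [::] [::] w else
  if w is x :: w' then
    (if k is k'.+1 then
       (-1) ^+ a *: shuffle_sum k' a (fun u v r => Psi (x :: u) v r) w' else 0)
    + (if a is a'.+1 then
         shuffle_sum k a' (fun u v r => Psi u (x :: v) r) w' else 0)
  else 0.
Proof. by case: w. Qed.

End ShuffleSum.

(** * The derived bracket on words *)

Section DerivedBracketWords.
Variables (F : fieldType) (g : lieAlgType F) (V : lmodType F) (rho : lieRep g V).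
Local Notation GV := (g * V)%type.

Lemma lieb0l (y : g) : lieb 0 y = 0.
Proof. exact: linear_map0 (lieb_linearl y). Qed.

Lemma lieb0r (y : g) : lieb y 0 = 0.
Proof. exact: linear_map0 (lieb_linearr y). Qed.

Lemma liebD (x y z : g) : lieb x (y + z) = lieb x y + lieb x z.
Proof. by have := lieb_linearr x 1 y z; rewrite !scale1r. Qed.

Lemma liebDl (x y z : g) : lieb (x + y) z = lieb x z + lieb y z.
Proof. by have := lieb_linearl z 1 x y; rewrite !scale1r. Qed.

Lemma liebC (x y : g) : lieb x y = - lieb y x.
Proof.
have := liebb (x + y); rewrite liebD !liebDl !liebb add0r addr0 addrC => /eqP.
by rewrite addr_eq0 => /eqP.
Qed.

Lemma liebN (x y : g) : lieb x (- y) = - lieb x y.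
Proof. by have := lieb_linearr x (-1) y 0; rewrite lieb0r !addr0 !scaleN1r. Qed.

Lemma rho0 v : rho 0 v = 0.
Proof. exact: linear_map0 (lieRep_linear rho v). Qed.

Definition lift_word (f : seq V -> g) : seq GV -> GV :=
  fun w => (f (map snd w), 0).

Definition mu_word (w : seq GV) : GV :=
  if w is [:: a; b] then (lieb a.1 b.1, rho a.1 b.2) else 0.

(** The vector acted on is the last letter, the one argument of an inserted cochain that is not
    shuffled. Inserting [anchor h] thus produces the terms $\rho(\phi(\dots))v_{k+n}$, with the
    fixed index $k+n$. *)
Definition anchor (f : seq V -> g) (w : seq V) : V :=
  if w is x :: w' then rho (f (belast x w')) (last x w') else 0.

Definition shuffle_bracket m n (f h : seq V -> g) : seq V -> g :=
  shuffle_sum m n (fun u v r => if r is [::] then lieb (f u) (h v) else 0).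

Lemma lift_word_linear : linear lift_word.
Proof.
move=> c f h; apply/funext => w; apply/eqP; rewrite xpair_eqE /=.
by rewrite scaler0 addr0 !eqxx.
Qed.

Lemma lift_word0 : lift_word 0 = 0.
Proof. by []. Qed.

Lemma lift_word_inj : injective lift_word.
Proof.
move=> f h e; apply/funext => w; have := congr1 (@^~ (map (pair 0) w)) e.
by rewrite /lift_word -map_comp map_id => -[].
Qed.

Lemma contract_lift_word x f :
  contract x (lift_word f) = lift_word (contract x.2 f).
Proof. by []. Qed.

Lemma cochain_lift n f : word_multilinear f -> word_supp n.+1 f ->
  cochain n (lift_word f).
Proof.
move=> lf sf; split => [u w c x y|w wn]; last first.
  by rewrite /lift_word sf // size_map.
apply/eqP; rewrite xpair_eqE /= !map_cat /=.
by rewrite scaler0 addr0 eqxx andbT; apply/eqP/lf.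
Qed.

(** A lifted cochain reads only the $V$-components of its arguments. *)
Lemma insertion_lift a (Q : seq GV -> GV) (Q' : seq V -> V) f :
  (forall w, (Q w).2 = Q' (map snd w)) ->
  insertion a Q (lift_word f) = lift_word (insertion a Q' f).
Proof.
move=> QQ'; apply/funext => w.
elim: w a Q Q' f QQ' => [|x w IH] [|a] Q Q' f QQ'.
- by rewrite /lift_word /= QQ'.
- by [].
- by rewrite /lift_word /= QQ'.
rewrite [LHS]/= contract_lift_word (IH _ _ Q') //.
rewrite (IH _ _ (contract x.2 Q')); last first.
  by move=> w'; apply: QQ'.
by apply/eqP; rewrite xpair_eqE /= scaler0 addr0 !eqxx.
Qed.

(** A lifted cochain has values in $\mathfrak g$, invisible to another one. Hence the lifted
    cochains commute for the Balavoine bracket. *)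
Lemma insertion_lift_lift a f h : word_multilinear f ->
  insertion a (lift_word h) (lift_word f) = 0.
Proof.
by move=> lf; rewrite (@insertion_lift a (lift_word h) 0 f) // insertion0l.
Qed.

Lemma contract0 (W : lmodType F) (E : lmodType F) (P : seq E -> W) :
  word_multilinear P -> contract 0 P = 0.
Proof. by move/contract_multilinear/linear_map0. Qed.

Lemma insertion_unary (E W : lmodType F) a (Q : seq E -> E) (P : seq E -> W) :
  word_multilinear P -> word_supp 1 P -> word_supp a Q ->
  insertion a Q P = fun w => P [:: Q w].
Proof.
move=> lP sP sQ; have P0 : P [:: 0] = 0 := linear_map0 (lP [::] [::]).
apply/funext => w; elim: w a Q sQ => [|x w IH] [|a] Q sQ //=.
- by rewrite sQ.
- by rewrite sP // sQ.
rewrite IH; last exact: word_supp_contract.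
rewrite insertion_supp0 ?scaler0 ?add0r //; exact: word_supp_contract.
Qed.

Lemma cochain_mu : cochain 1 mu_word.
Proof.
split=> [u w c x y|[|a[|b[|z w]]]] //.
case: u => [|a [|b u]] /=.
- case: w => [|b [|z w]]; rewrite ?scaler0 ?addr0 //.
  by apply/eqP; rewrite xpair_eqE /= lieb_linearl lieRep_linear !eqxx.
- case: w => [|b w]; rewrite ?scaler0 ?addr0 //.
  by apply/eqP; rewrite xpair_eqE /= lieb_linearr linearP !eqxx.
by case: u => [|z u]; rewrite /= ?scaler0 ?addr0.
Qed.

(** On three letters this is the left Leibniz identity of the hemisemidirect product of $\mathfrak
    g$ and $V$: the Jacobi identity in the first component, the representation axiom in the
    second. *)
Lemma mu_mu : insertion 2 mu_word mu_word = 0.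
Proof.
have [lm sm] := cochain_mu; apply/funext => w.
have [w3|wn3] := eqVneq (size w) 3; last first.
  by rewrite (word_supp_insertion (b := 1)).
case: w w3 => [|x [|y [|z [|? ?]]]] //= _.
apply/eqP; rewrite xpair_eqE /= !expr1 !expr0 !scaler0 !addr0 !add0r.
rewrite !scale1r !scaleN1r; apply/andP; split; apply/eqP; last first.
  by rewrite lieRep_lieb; zmod.
rewrite -[RHS]oppr0 -[in RHS](lieb_jacobi x.1 y.1 z.1) (liebC (lieb x.1 y.1)).
by rewrite (liebC z.1 x.1) liebN; zmod.
Qed.

Lemma shuffle_bracket0l n f h : word_supp n h ->
  shuffle_bracket 0 n f h = fun w => lieb (f [::]) (h w).
Proof.
move=> sh; apply/funext => w; elim: w n h sh => [|x w IH] [|n] h sh //.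
- by rewrite sh // lieb0r.
- by rewrite sh // lieb0r.
rewrite /shuffle_bracket /= add0r.
exact: (IH n (contract x h) (word_supp_contract x sh)).
Qed.

Lemma shuffle_bracket0r m f h : word_supp m f ->
  shuffle_bracket m 0 f h = fun w => lieb (f w) (h [::]).
Proof.
move=> sf; apply/funext => w; elim: w m f sf => [|x w IH] [|m] f sf //.
- by rewrite sf // lieb0l.
- by rewrite sf // lieb0l.
rewrite /shuffle_bracket /= addr0 scale1r.
exact: (IH m (contract x f) (word_supp_contract x sf)).
Qed.

(** Both slots of $\mu$ get filled, the first by whichever of [f], [h] is completed first.
    Skew-symmetry of the Lie bracket merges the two cases into one sum over all shuffles. *)
Lemma mu_lift_lift m n f h : word_multilinear f -> word_multilinear h ->
  word_supp m f -> word_supp n h ->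
  insertion n (lift_word h) (insertion m (lift_word f) mu_word) =
  lift_word ((-1) ^+ m *: shuffle_bracket m n f h).
Proof.
have [lm sm] := cochain_mu.
have lmx x : word_multilinear (contract x mu_word).
  exact: word_multilinear_contract.
have smx x : word_supp 1 (contract x mu_word) by exact: word_supp_contract.
have s_lift k f' : word_supp k f' -> word_supp k (lift_word f').
  by move=> sf w wk; rewrite /lift_word sf // size_map.
(* [f] is complete and sits in the first slot; [h] takes all the remaining letters. *)
have base0 n' f' h' : word_supp 0 f' -> word_supp n' h' ->
    insertion n' (lift_word h') (insertion 0 (lift_word f') mu_word) =
    lift_word (shuffle_bracket 0 n' f' h').
  move=> sf sh; rewrite shuffle_bracket0l // insertion0.
  rewrite (insertion_unary _ _ (s_lift _ _ sh)) //; apply/funext => w.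
  by rewrite /contract /lift_word /= linear0.
(* [h] is complete first: the result is $[h,f]$, and $-[f,h]$ accounts for the exponent [m'.+1]
   instead of [m']. *)
have base1 m' f' h' : word_multilinear f' -> word_supp m'.+1 f' ->
    insertion 0 (lift_word h') (insertion m'.+1 (lift_word f') mu_word) =
    lift_word ((-1) ^+ m'.+1 *: shuffle_bracket m'.+1 0 f' h').
  move=> lf sf; rewrite shuffle_bracket0r // insertion0 contract_insertion.
  rewrite contract_lift_word contract0 // lift_word0 insertion0l // addr0.
  rewrite (insertion_unary _ _ (s_lift _ _ sf)) //; apply/funext => w.
  apply/eqP; rewrite xpair_eqE /= linear0 scaler0 eqxx andbT exprS mulN1r.
  rewrite scaleNr -scalerN; apply/eqP.
  by rewrite -[RHS]/(_ *: - lieb (f' (map snd w)) (h' [::])) -liebC.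
(* If a letter occupies the first slot of $\mu$, then [h] could only be inserted into [f], which
   gives 0. *)
have unit0 m' n' f' h' x : word_multilinear f' -> word_supp m' f' ->
    insertion n' (lift_word h')
      (insertion m' (lift_word f') (contract x mu_word)) = 0.
  move=> lf sf; rewrite (insertion_unary _ _ (s_lift _ _ sf)) //.
  rewrite (@insertion_comp _ _ _ n' _ (lift_word f') _ (fun y => mu_word [:: x; y])).
    by rewrite insertion_lift_lift //; apply/funext => w; rewrite /= lieb0r linear0.
  by move=> c y z; exact: (lm [:: x] [::]).
move=> lf lh sf sh; case: m sf => [|m] sf; first by rewrite expr0 scale1r base0.
case: n sh => [|n] sh; first by rewrite base1.
apply/funext => w; elim: w m n f h lf lh sf sh => [|x w IH] m n f h lf lh sf sh.
  by rewrite -[RHS]/((-1) ^+ m.+1 *: (0 : g), (0 : V)) scaler0.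
have lfx := word_multilinear_contract x.2 lf.
have lhx := word_multilinear_contract x.2 lh.
have sfx := word_supp_contract x.2 sf.
have shx := word_supp_contract x.2 sh.
rewrite -[LHS]/(contract x (insertion n.+1 (lift_word h)
  (insertion m.+1 (lift_word f) mu_word)) w).
rewrite !contract_insertion !contract_lift_word insertionDr insertionZr unit0 //.
rewrite scaler0 add0r.
rewrite -[LHS]/((-1) ^+ n *: insertion n.+1 (lift_word h)
    (insertion m (lift_word (contract x.2 f)) mu_word) w
  + insertion n (lift_word (contract x.2 h))
    (insertion m.+1 (lift_word f) mu_word) w).
have -> : insertion n.+1 (lift_word h)
    (insertion m (lift_word (contract x.2 f)) mu_word) w =
    lift_word ((-1) ^+ m *: shuffle_bracket m n.+1 (contract x.2 f) h) w.
  case: m {sf} sfx => [|m] sfx; last exact: IH.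
  by rewrite expr0 scale1r base0.
have -> : insertion n (lift_word (contract x.2 h))
    (insertion m.+1 (lift_word f) mu_word) w =
    lift_word ((-1) ^+ m.+1 *: shuffle_bracket m.+1 n f (contract x.2 h)) w.
  case: n {sh} shx => [|n] shx; last exact: IH.
  by rewrite base1.
apply/eqP; rewrite xpair_eqE /= scaler0 addr0 eqxx andbT; apply/eqP.
rewrite -![(_ *: shuffle_bracket _ _ _ _) _]/(_ *: shuffle_bracket _ _ _ _ _).
rewrite [shuffle_bracket m.+1 n.+1 f h _]/= scalerDr.
rewrite -/(shuffle_bracket m n.+1 (contract x.2 f) h (map snd w)).
rewrite -/(shuffle_bracket m.+1 n f (contract x.2 h) (map snd w)).
odd_signs; case: (odd m); case: (odd n); simpl_signs; zmod.
Qed.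

(** With [h] in the second slot, $\rho$ acts on the zero $V$-component of its value. With [h] in the
    first slot, it takes all letters but the last, so there is nothing to shuffle. *)
Lemma mu_lift_snd n h w : word_supp n h ->
  (insertion n (lift_word h) mu_word w).2 = anchor h (map snd w).
Proof.
have [lm sm] := cochain_mu.
have s_lift k f' : word_supp k f' -> word_supp k (lift_word f').
  by move=> sf u wk; rewrite /lift_word sf // size_map.
elim: w n h => [|x w IH] [|n] h sh //=.
  case: w {IH} => [|y w] //=.
  by rewrite sh // rho0.
rewrite (insertion_unary _ _ (s_lift _ _ sh)); first last.
- exact: word_supp_contract.
- exact: word_multilinear_contract.
rewrite {1}/contract /lift_word /= linear0 scaler0 add0r.
rewrite (IH _ (contract x.2 h)); last exact: word_supp_contract.
case: w {IH} => [|y w] //=.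
by rewrite (sh [::]) // rho0.
Qed.

End DerivedBracketWords.

(** * The derived bracket of two lifted cochains *)

Section DerivedFormula.
Variables (F : fieldType) (g : lieAlgType F) (V : lmodType F) (rho : lieRep g V).
Local Notation mu := (mu_word rho).

Lemma lift_wordD (f h : seq V -> g) :
  lift_word (f + h) = lift_word f + lift_word h.
Proof. by have := lift_word_linear 1 f h; rewrite !scale1r. Qed.

Lemma lift_wordZ c (f : seq V -> g) : lift_word (c *: f) = c *: lift_word f.
Proof. by have := lift_word_linear c f 0; rewrite !addr0. Qed.

Lemma lift_wordN (f : seq V -> g) : lift_word (- f) = - lift_word f.
Proof. by rewrite -scaleN1r lift_wordZ scaleN1r. Qed.

Lemma insertion_lift_snd k P (f : seq V -> g) w :
  (insertion k P (lift_word f) w).2 = 0.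
Proof.
transitivity (insertion k P (fun w => (lift_word f w).2) w).
  by rewrite (insertion_comp k P (lift_word f) (L := snd)).
by rewrite (insertionr0 V k P).
Qed.

Lemma derived_word_lift m n (f h : seq V -> g) :
  word_multilinear f -> word_multilinear h ->
  word_supp m.+1 f -> word_supp n.+1 h ->
  derived_word mu m n (lift_word f) (lift_word h) =
  lift_word ((-1) ^+ (m.+1 * n.+1) *: insertion m.+2 (anchor rho f) h
             - insertion n.+2 (anchor rho h) f - shuffle_bracket m.+1 n.+1 f h).
Proof.
move=> lf lh sf sh; have c_mu := cochain_mu rho.
have [cf ch] := (cochain_lift lf sf, cochain_lift lh sh).
(* Write $P\circ Q$ for [Q] inserted into [P]. In the pre-Lie identity for $f,\mu,h$ the terms
   $(f\circ h)\circ\mu$ and $f\circ(h\circ\mu)$ vanish, the latter because $h\circ\mu$ has values in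
   $\mathfrak g$. So $(f\circ\mu)\circ h=f\circ(\mu\circ h)$, where only the $V$-component of
   $\mu\circ h$ counts. *)
have mu_h : insertion n.+1 (lift_word h) (insertion 2 mu (lift_word f)) =
    lift_word (insertion n.+2 (anchor rho h) f).
  have := insertion_assoc cf c_mu ch.
  rewrite insertion_lift_lift // insertionr0.
  rewrite (@insertion_lift _ _ _ _ (insertion 2 mu (lift_word h)) 0); last first.
    by move=> w; apply: insertion_lift_snd.
  rewrite insertion0l // lift_word0 subrr scaler0 subr0 => <-.
  by apply: insertion_lift => w; apply: mu_lift_snd.
have d_f : insertion m.+2 (word_bracket 1 m mu (lift_word f)) (lift_word h) =
    lift_word (insertion m.+2 (anchor rho f) h).
  apply: insertion_lift => w.
  rewrite -(mu_lift_snd _ _ sf) -[LHS]/((insertion m.+1 (lift_word f) mu w).2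
    - (-1) ^+ (1 * m) *: (insertion 2 mu (lift_word f) w).2).
  by rewrite insertion_lift_snd scaler0 subr0.
rewrite /derived_word {1}/word_bracket d_f {1}/word_bracket -scaleNr.
rewrite insertionDr insertionZr mu_h mu_lift_lift //.
rewrite !(lift_wordD, lift_wordN, lift_wordZ) !scalerDr !scaleNr !scalerN.
odd_signs; case: (odd m); case: (odd n); simpl_signs; zmod.
Qed.

End DerivedFormula.

(** * Shuffle permutations *)

Section ShufflePerm.

Definition is_shuffle n k (s : 'S_n) :=
  [forall a : 'I_n, forall b : 'I_n,
      (a < b)%N && ((b < k)%N || (k <= a)%N) ==> (s a < s b)%N].

Lemma is_shuffleP n k (s : 'S_n) :
  reflect (forall a b : 'I_n, (a < b)%N -> (b < k)%N || (k <= a)%N -> (s a < s b)%N)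
    (is_shuffle k s).
Proof.
apply: (iffP forallP) => [H a b ab abk|H a].
  by have /forallP/(_ b)/implyP := H a; apply; rewrite ab abk.
by apply/forallP => b; apply/implyP => /andP[]; apply: H.
Qed.

Lemma is_shuffle_lift0 n k (s : 'S_n) :
  is_shuffle k.+1 (lift_perm ord0 ord0 s) = is_shuffle k s.
Proof.
apply/is_shuffleP/is_shuffleP => H a b.
  move=> ab abk; have := H (lift ord0 a) (lift ord0 b).
  by rewrite !lift_perm_lift /= /bump /= !add1n !ltnS; apply.
case: (unliftP ord0 a) => [a' ->|->]; case: (unliftP ord0 b) => [b' ->|->] //.
- by rewrite !lift_perm_lift /= /bump /= !add1n !ltnS; apply: H.
- by rewrite lift_perm_lift lift_perm_id.
Qed.

Lemma is_shuffle_liftk n k (kn : (k < n.+1)%N) (s : 'S_n) :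
  is_shuffle k (lift_perm (Ordinal kn) ord0 s) = is_shuffle k s.
Proof.
apply/is_shuffleP/is_shuffleP => H a b.
  move=> ab abk; have := H (lift (Ordinal kn) a) (lift (Ordinal kn) b).
  rewrite !lift_perm_lift /= /bump /= !add1n !ltnS; apply; move: ab abk; lia.
case: (unliftP (Ordinal kn) a) => [a' ->|->];
  case: (unliftP (Ordinal kn) b) => [b' ->|->] //.
- rewrite !lift_perm_lift /= /bump /= !add1n !ltnS => ab abk.
  by apply: H; move: ab abk; lia.
- by rewrite lift_perm_lift lift_perm_id /= /bump; lia.
- by rewrite lift_perm_lift lift_perm_id /= /bump; lia.
- by rewrite ltnn.
Qed.

(** [i] is the position of the value 0. Inside a block it would be preceded by a smaller value, so
    it starts one of the two blocks. *)
Lemma is_shuffle_pos0 n k (i : 'I_n.+1) (s : 'S_n) :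
  is_shuffle k (lift_perm i ord0 s) -> (i == 0%N :> nat) || (i == k :> nat).
Proof.
move/is_shuffleP => H; have [->//|i0] := eqVneq (i : nat) 0%N.
apply/eqP/eqP; apply: contraT => ik.
have lt_i : (i.-1 < n.+1)%N by have := ltn_ord i; lia.
have := H (Ordinal lt_i) i; rewrite lift_perm_id /= ltn0 => /(_ _ _)/negP[] //; lia.
Qed.

(** A permutation is given by the position of 0 and the permutation left after removing it;
    injectivity suffices, since $(n+1)\cdot n!=(n+1)!$. *)
Lemma lift_perm0_bij n :
  bijective (fun p : 'I_n.+1 * 'S_n => lift_perm p.1 ord0 p.2).
Proof.
apply: inj_card_bij; last by rewrite card_prod !card_Sn card_ord factS.
move=> [i s] [j t] /= e.
have ij : i = j.
  by apply: (@perm_inj _ (lift_perm j ord0 t)); rewrite -{1}e !lift_perm_id.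
rewrite ij in e *; congr pair; apply/permP => l.
by have /permP/(_ (lift j l)) := e; rewrite !lift_perm_lift => /lift_inj.
Qed.

Lemma sum_shuffle (W : nmodType) n k (G : 'S_n.+1 -> W) : (k <= n.+1)%N ->
  \sum_(s | is_shuffle k s) G s =
  (if k is k'.+1 then \sum_(s : 'S_n | is_shuffle k' s) G (lift_perm ord0 ord0 s)
   else 0)
  + (if (k <= n)%N then
       \sum_(s : 'S_n | is_shuffle k s) G (lift_perm (inord k) ord0 s)
     else 0).
Proof.
move=> kn; rewrite (reindex (fun p : 'I_n.+1 * 'S_n => lift_perm p.1 ord0 p.2)) /=;
  last exact/onW_bij/lift_perm0_bij.
rewrite -(pair_big_dep xpredT (fun i s => is_shuffle k (lift_perm i ord0 s))
            (fun i s => G (lift_perm i ord0 s))) /=.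
have zero (i : 'I_n.+1) : i != 0%N :> nat -> i != k :> nat ->
    \sum_(s | is_shuffle k (lift_perm i ord0 s)) G (lift_perm i ord0 s) = 0.
  move=> i0 ik; apply: big_pred0 => s; apply/negP => /is_shuffle_pos0.
  by rewrite (negbTE i0) (negbTE ik).
have at_k (k_n : (k < n.+1)%N) :
    \sum_(s | is_shuffle k (lift_perm (inord k) ord0 s))
       G (lift_perm (inord k) ord0 s)
    = \sum_(s : 'S_n | is_shuffle k s) G (lift_perm (inord k) ord0 s).
  have -> : inord k = Ordinal k_n by apply: val_inj; rewrite /= inordK.
  by apply: eq_bigl => s; rewrite is_shuffle_liftk.
(* For [k = 0] the two possible positions coincide, and the second summand alone counts them. *)
case: k kn zero at_k => [|k] kn zero at_k.
  rewrite (bigD1 (inord 0)) //= at_k // add0r -[RHS]addr0; congr (_ + _).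
  by apply: big1 => i; rewrite -val_eqE /= inordK // => i0; apply: zero.
rewrite (bigD1 ord0) //=; congr (_ + _).
  by apply: eq_bigl => s; rewrite is_shuffle_lift0.
have [k_n|k_n] := leqP k.+1 n.
  have k0 : inord k.+1 != ord0 :> 'I_n.+1 by rewrite -val_eqE /= inordK.
  rewrite (bigD1 (inord k.+1)) //= at_k // -[RHS]addr0; congr (_ + _).
  apply: big1 => i.
  move=> /andP[i0 ik]; apply: zero => //; apply: contraNneq ik => ik.
  by apply/eqP/val_inj; rewrite /= inordK.
rewrite big1 // => i; rewrite -val_eqE /= => i0; apply: zero => //.
by have := ltn_ord i; lia.
Qed.

End ShufflePerm.

Section ShuffleSumPerm.

Lemma perm_nat_ord n (s : 'S_n) (i : 'I_n) : perm_nat s i = s i.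
Proof. by rewrite /perm_nat valK. Qed.

Lemma perm_nat_lift n (i : 'I_n.+1) (s : 'S_n) j :
  perm_nat (lift_perm i ord0 s) (bump i j) = (perm_nat s j).+1.
Proof.
have [jn|nj] := ltnP j n; last first.
  by rewrite !perm_nat_id // /bump; have := ltn_ord i; lia.
rewrite (perm_nat_ord s (Ordinal jn)).
by rewrite (perm_nat_ord _ (lift i (Ordinal jn))) lift_perm_lift.
Qed.

Lemma perm_nat_lift_id n (i : 'I_n.+1) (s : 'S_n) :
  perm_nat (lift_perm i ord0 s) i = 0%N.
Proof. by rewrite perm_nat_ord lift_perm_id. Qed.

Variables (F : fieldType) (E : lmodType F) (W : lmodType F).

(** With total length [n] and second block [n - k], the induction removes one letter from ['S_n.+1]
    to ['S_n] without casts between [k + a.+1] and [(k + a).+1]. *)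
Lemma shuffle_sum_is_shuffle n k (Psi : seq E -> seq E -> seq E -> W) w :
  (k <= n <= size w)%N ->
  shuffle_sum k (n - k)%N Psi w =
  \sum_(s : 'S_n | is_shuffle k s) ((-1) ^+ (k * (n - k)) * (-1) ^+ s) *:
    Psi [seq nth 0 w (perm_nat s i) | i <- iota 0 k]
        [seq nth 0 w (perm_nat s i) | i <- iota k (n - k)%N] (drop n w).
Proof.
elim: n k Psi w => [|n IH] k Psi w /andP[kn nw].
  move: kn; rewrite leqn0 => /eqP->; rewrite shuffle_sumE /= drop0.
  rewrite (big_pred1 1%g) => [|s]; first by rewrite odd_perm1 mulr1 scale1r.
  rewrite /=; have -> : s = 1%g by apply/permP => -[].
  by rewrite eqxx; apply/is_shuffleP => -[].
case: w nw => // x w nw; rewrite sum_shuffle // shuffle_sumE.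
have -> : (k == 0%N) && (n.+1 - k == 0)%N = false by lia.
congr (_ + _).
  case: k kn => // k kn; rewrite subSS IH ?scaler_sumr; last by rewrite -ltnS kn.
  apply: eq_bigr => s _; rewrite scalerA odd_lift_perm /= mulrA -exprD -mulSn.
  congr (_ *: Psi _ _ _).
    rewrite /= (perm_nat_lift_id ord0); congr cons.
    rewrite -[1%N]addn0 iotaDl -map_comp; apply: eq_map => i /=.
    by rewrite (perm_nat_lift ord0).
  rewrite -[k.+1]add1n iotaDl -map_comp; apply: eq_map => i /=.
  by rewrite (perm_nat_lift ord0).
have [kn'|nk] := leqP k n; last by have -> : (n.+1 - k = 0)%N by lia.
rewrite subSn // IH; last by rewrite kn'.
have ik : (inord k : 'I_n.+1) = k :> nat by rewrite inordK.
apply: eq_bigr => s _; rewrite odd_lift_perm ik addbF signr_addb signr_odd.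
(* Moving 0 to position [k] costs $(-1)^k$, and the extra sign $(-1)^{ka}$ changes by the same
   factor. Hence letters of the second block carry no sign in [shuffle_sum]. *)
have e : (k * (n - k).+1 + k = k * (n - k) + 2 * k)%N by lia.
rewrite mulrA -[in RHS]exprD e exprD (exprM _ 2) sqrrN !expr1n mulr1.
congr (_ *: Psi _ _ _).
  apply/eq_in_map => i; rewrite mem_iota add0n /= => ik'.
  have := perm_nat_lift (inord k) s i; rewrite ik /bump leqNgt ik' add0n => ->.
  by [].
have e0 := perm_nat_lift_id (inord k) s; rewrite ik in e0.
rewrite /= e0; congr cons.
rewrite -[k.+1]add1n iotaDl -map_comp; apply/eq_in_map => i.
rewrite mem_iota /= => /andP[ki _].
by have := perm_nat_lift (inord k) s i; rewrite ik /bump ki => ->.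
Qed.

Lemma shuffle_sum_perm k a (Psi : seq E -> seq E -> seq E -> W) w :
  (k + a <= size w)%N ->
  shuffle_sum k a Psi w =
  \sum_(s in shuffles k a) ((-1) ^+ (k * a) * (-1) ^+ s) *:
    Psi [seq nth 0 w (perm_nat s i) | i <- iota 0 k]
        [seq nth 0 w (perm_nat s i) | i <- iota k a] (drop (k + a)%N w).
Proof.
move=> kaw; have := @shuffle_sum_is_shuffle (k + a) k Psi w.
have e : (k + a - k = a)%N by lia.
rewrite leq_addr kaw !e => -> //.
by apply: eq_bigl => s; rewrite inE.
Qed.

(** Both sides obey the same recursion on the first letter. [k] letters precede the slot of [Q], and
    [y], the first letter after the shuffled blocks, is its last argument. *)
Lemma insertion_shuffle a (Q : seq E -> E) (P : seq E -> W) w :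
  insertion a.+1 Q P w = \sum_(k < (size w - a)%N)
    shuffle_sum k a (fun u v r =>
      if r is y :: r' then P (u ++ Q (rcons v y) :: r') else 0) w.
Proof.
elim: w a Q P => [|x w IH] a Q P; first by rewrite sub0n big_ord0.
rewrite [LHS]/= IH; case: a => [|a].
  rewrite !subn0 [size _]/= big_ord_recl [LHS]addrC; congr (_ + _).
    by case: w {IH}.
  by rewrite scaler_sumr; apply: eq_bigr => k _; rewrite [RHS]/= addr0.
rewrite IH [size _]/= subSS.
(* The first letter joins the left block, shifting [k] by one and leaving nothing for [k = 0], or
   the block of [Q]. *)
transitivity (\sum_(k < (size w - a)%N)
   ((if k : nat is k'.+1 then (-1) ^+ a.+1 *: shuffle_sum k' a.+1 (fun u v r =>
      if r is y :: r' then P ((x :: u) ++ Q (rcons v y) :: r') else 0) w else 0)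
    + shuffle_sum k a (fun u v r =>
      if r is y :: r' then P (u ++ Q (rcons (x :: v) y) :: r') else 0) w)).
  rewrite big_split /=; congr (_ + _); rewrite subnS.
  case: (size w - a)%N => [|d]; first by rewrite !big_ord0 scaler0.
  by rewrite big_ord_recl add0r scaler_sumr.
by apply: eq_bigr => k _; rewrite [RHS]/= andbF.
Qed.

End ShuffleSumPerm.

(** * From multilinear maps to functions on words *)

Section WordFun.
Variables (F : fieldType) (E W : lmodType F).

(** Extended by zero to the words of length other than [n]. *)
Definition word_fun n (f : ('I_n -> E) -> W) (w : seq E) : W :=
  if size w == n then f (fun i => nth 0 w i) else 0.

Lemma word_fun_supp n (f : ('I_n -> E) -> W) : word_supp n (word_fun f).
Proof. by move=> w /negbTE wn; rewrite /word_fun wn. Qed.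

Lemma word_fun_multilinear n (f : multilin n E W) :
  word_multilinear (word_fun f).
Proof.
move=> u w; rewrite /word_fun => c x y; rewrite !size_cat /=.
case: eqP => [uwn|]; last by rewrite scaler0 addr0.
have un : (size u < n)%N by rewrite -uwn -addSnnS leq_addr.
apply: (multilin_comp_linear f (fun x (i : 'I_n) => nth 0 (u ++ x :: w) i)
  (Ordinal un)) => [b d e|l d e].
  by rewrite /= !nth_cat ltnn subnn.
rewrite -val_eqE /= !nth_cat => lu; case: ltnP => // ul.
case lE: (l - size u)%N => [|i] //.
by move/eqP: lE; rewrite subn_eq0 leq_eqVlt (negbTE lu) ltnNge ul.
Qed.

Lemma word_fun_linear n : linear (fun f : multilin n E W => word_fun f).
Proof.
move=> c f h; apply/funext => w.
rewrite -[RHS]/(c *: word_fun f w + word_fun h w) /word_fun.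
by case: ifP => _ //; rewrite scaler0 addr0.
Qed.

Lemma nth_codom n (v : 'I_n.+1 -> E) i : (i < n.+1)%N ->
  nth 0 (codom v) i = v (inord i).
Proof.
move=> iN; rewrite codomE (nth_map ord0) ?size_enum_ord //.
by congr v; apply: val_inj; rewrite /= nth_enum_ord // inordK.
Qed.

Lemma word_fun_codom n (f : ('I_n.+1 -> E) -> W) v : word_fun f (codom v) = f v.
Proof.
rewrite /word_fun size_codom card_ord eqxx; congr f; apply/funext => i.
by rewrite nth_codom // inord_val.
Qed.

Lemma word_fun_inj n (f h : multilin n.+1 E W) : word_fun f = word_fun h -> f = h.
Proof.
by move=> e; apply: multilin_eqP => v; rewrite -!word_fun_codom e.
Qed.

Lemma word_fun_degcast m n (e : m = n) (f : multilin m.+1 E W) :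
  word_fun (degcast (L := fun k => multilin k.+1 E W) e f) = word_fun f.
Proof. by case: _ / e. Qed.

Lemma insertion_perm p q (Q : seq E -> E) (P : ('I_p.+1 -> E) -> W) w :
  size w = (p + q).+1%N ->
  insertion q.+1 Q (word_fun P) w =
  \sum_(k < p.+1) \sum_(s in shuffles k q) ((-1) ^+ (k * q) * (-1) ^+ s) *:
    P (fun j : 'I_p.+1 =>
         if (j < k)%N then nth 0 w (perm_nat s j)
         else if j == k then
           Q (rcons [seq nth 0 w (perm_nat s i) | i <- iota k q] (nth 0 w (k + q)%N))
         else nth 0 w (j + q)%N).
Proof.
move=> wpq; rewrite insertion_shuffle wpq.
have -> : ((p + q).+1 - q = p.+1)%N by lia.
apply: eq_bigr => k _; have kp := ltn_ord k.
rewrite shuffle_sum_perm; last by rewrite wpq; lia.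
apply: eq_bigr => s _; congr (_ *: _).
rewrite (drop_nth 0); last by rewrite wpq; lia.
rewrite /word_fun size_cat /= size_map size_iota size_drop wpq.
have -> : (k + ((p + q).+1 - (k + q).+1).+1)%N == p.+1 by lia.
congr P; apply/funext => j; have jp := ltn_ord j.
rewrite nth_cat size_map size_iota; case: ltnP => jk.
  by rewrite (nth_map 0%N) ?size_iota // nth_iota.
have [->|jk'] := eqVneq j k; first by rewrite subnn.
have e : (j - k = (j - k.+1).+1)%N by move: jk'; rewrite -val_eqE /=; lia.
rewrite e /= nth_drop; congr nth; lia.
Qed.

End WordFun.

Lemma word_fun_comp (F : fieldType) (E : lmodType F) p q
    (P : multilin p.+1 E E) (Q : multilin q.+1 E E) :
  word_fun (balavoine_comp P Q) = insertion q.+1 (word_fun Q) (word_fun P).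
Proof.
apply/funext => w; have [wpq|wpq] := eqVneq (size w) (p + q).+1; last first.
  have sI : word_supp (p + q).+1 (insertion q.+1 (word_fun Q) (word_fun P)).
    rewrite addnC -addSn.
    exact: word_supp_insertion (@word_fun_supp _ _ _ _ Q) (@word_fun_supp _ _ _ _ P).
  by rewrite sI // word_fun_supp.
rewrite insertion_perm // /word_fun wpq eqxx /balavoine_comp.
have sumE n (h : 'I_n -> multilin (p + q).+1 E E) v :
    (\sum_i h i) v = \sum_i h i v.
  by elim/big_ind2: _ => // x a y b <- <-.
rewrite sumE; apply: eq_bigr => k _; have kp := ltn_ord k.
apply: eq_bigr => s _; congr (_ *: multilin_fun P _); apply/funext => j.
have jp := ltn_ord j.
case: ltnP => jk; first by rewrite inordK //; apply: perm_nat_lt_le; lia.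
case: eqP => _; last by rewrite inordK //; lia.
rewrite size_rcons size_map size_iota eqxx; congr (multilin_fun Q _).
apply/funext => l; have lq := ltn_ord l.
rewrite inordK; last by apply: perm_nat_lt_le; lia.
rewrite nth_rcons size_map size_iota; case: ltnP => ql.
  by rewrite (nth_map 0%N) ?size_iota // nth_iota.
have -> : (l : nat) = q by lia.
by rewrite eqxx perm_nat_id.
Qed.

Lemma word_fun_balavoine (F : fieldType) (E : lmodType F) p q
    (P : multilin p.+1 E E) (Q : multilin q.+1 E E) :
  word_fun (balavoine P Q) = word_bracket p q (word_fun P) (word_fun Q).
Proof.
rewrite /balavoine addrC -scaleNr word_fun_linear word_fun_degcast.
by rewrite !word_fun_comp scaleNr addrC.
Qed.

(** * The graded Lie algebra of multilinear maps *)

Section DerivedBracketTheorem.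
Variables (F : fieldType) (g : lieAlgType F) (V : lmodType F) (rho : lieRep g V).
Local Notation mu := (mu_word rho).

Lemma word_fun_mu_rho : word_fun (mu_rho rho) = mu.
Proof. by apply/funext => -[|a [|b [|c w]]]. Qed.

Lemma word_fun_lift_hom m (f : multilin m.+1 V g) :
  word_fun (lift_hom f) = lift_word (word_fun f).
Proof.
apply/funext => w; rewrite /word_fun /lift_word size_map.
case: eqP => // wm; congr pair; rewrite /=; congr (multilin_fun f _).
by apply/funext => i; rewrite (nth_map 0) // wm.
Qed.

Lemma word_fun_restr_hom m (P : multilin m.+1 (g * V)%type (g * V)%type) w :
  word_fun (restr_hom P) w = (word_fun P (map (pair 0) w)).1.
Proof.
rewrite /word_fun size_map; case: eqP => // wm; congr (multilin_fun P _).1.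
by apply/funext => i; rewrite (nth_map 0) // wm.
Qed.

Lemma word_fun_derived_cochain m n (f : multilin m.+1 V g) (h : multilin n.+1 V g) :
  word_fun (derived_cochain rho f h) =
  derived_word mu m n (lift_word (word_fun f)) (lift_word (word_fun h)).
Proof.
rewrite /derived_cochain word_fun_degcast -[_ *: _]addr0 word_fun_linear.
have -> : word_fun (0 : multilin _ (g * V)%type (g * V)%type) = 0.
  by move=> ?; apply/funext => w; rewrite /word_fun; case: ifP.
by rewrite addr0 !word_fun_balavoine !word_fun_lift_hom word_fun_mu_rho.
Qed.

Definition derived_formula m n (f h : seq V -> g) : seq V -> g :=
  (-1) ^+ (m.+1 * n.+1) *: insertion m.+2 (anchor rho f) h
  - insertion n.+2 (anchor rho h) f - shuffle_bracket m.+1 n.+1 f h.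

Lemma word_fun_derived_bracket m n (f : multilin m.+1 V g) (h : multilin n.+1 V g) :
  word_fun (derived_bracket rho f h : multilin (m + n.+1).+1 V g) =
  derived_formula m n (word_fun f) (word_fun h).
Proof.
apply/funext => w; rewrite word_fun_restr_hom word_fun_derived_cochain.
rewrite derived_word_lift; try exact: word_fun_multilinear; try exact: word_fun_supp.
by rewrite /lift_word /= -map_comp map_id.
Qed.

(** [derived_bracket] restricts the derived cochain to $V$ and projects it to $\mathfrak g$; nothing
    is lost, as by [derived_word_lift] this cochain is itself a lift. *)
Lemma lift_derived_bracket m n (f : multilin m.+1 V g) (h : multilin n.+1 V g) :
  lift_word (word_fun (derived_bracket rho f h : multilin (m + n.+1).+1 V g)) =
  derived_word mu m n (lift_word (word_fun f)) (lift_word (word_fun h)).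
Proof.
rewrite word_fun_derived_bracket derived_word_lift //;
  try exact: word_fun_multilinear; exact: word_fun_supp.
Qed.

Definition graded_word k : graded_hom g V k -> seq V -> g :=
  if k is k'.+1 then fun f : multilin k'.+1 V g => word_fun f else fun=> 0.

Lemma graded_word_inj k : injective (@graded_word k).
Proof.
by case: k => [x y _|k x y]; [rewrite (thinmx0 x) (thinmx0 y)|exact: word_fun_inj].
Qed.

Lemma graded_word_linear k : linear (@graded_word k).
Proof.
by case: k => [c x y|k]; [rewrite /= scaler0 addr0|exact: word_fun_linear].
Qed.

Lemma graded_word_degcast m n (e : m = n) (x : graded_hom g V m) :
  graded_word (degcast (L := fun k => graded_hom g V k) e x) = graded_word x.
Proof. by case: _ / e. Qed.

Lemma graded_hom0 (x : graded_hom g V 0) : x = 0.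
Proof. exact: thinmx0. Qed.

Lemma graded_word0 k : @graded_word k 0 = 0.
Proof.
by case: k => // k; apply/funext => w; rewrite /= /word_fun; case: ifP.
Qed.

Lemma graded_wordZ k c x : @graded_word k (c *: x) = c *: graded_word x.
Proof. by have := graded_word_linear c x 0; rewrite graded_word0 !addr0. Qed.

Lemma graded_wordN k x : @graded_word k (- x) = - graded_word x.
Proof. by rewrite -scaleN1r graded_wordZ scaleN1r. Qed.

Lemma cochain_graded k (x : graded_hom g V k.+1) :
  cochain k (lift_word (graded_word x)).
Proof.
by apply: cochain_lift; [exact: word_fun_multilinear | exact: word_fun_supp].
Qed.

Local Notation br := (graded_derived_bracket rho).

Lemma lift_graded_bracket m n (x : graded_hom g V m.+1) (y : graded_hom g V n.+1) :
  lift_word (graded_word (br x y)) =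
  derived_word mu m n (lift_word (graded_word x)) (lift_word (graded_word y)).
Proof. exact: lift_derived_bracket. Qed.

Lemma bracket_lift0 m n (x : graded_hom g V m.+1) (y : graded_hom g V n.+1) :
  word_bracket m n (lift_word (graded_word x)) (lift_word (graded_word y)) = 0.
Proof.
by rewrite /word_bracket !insertion_lift_lift ?scaler0 ?subrr //;
  exact: word_fun_multilinear.
Qed.

Lemma graded_bracket_linearl m n (y : graded_hom g V n) :
  linear (fun x : graded_hom g V m => br x y).
Proof.
move=> c x x'; case: m x x' => [|m] x x'; first by rewrite /= scaler0 addr0.
case: n y => [|n] y; first by rewrite /= scaler0 addr0.
apply/graded_word_inj/lift_word_inj.
rewrite graded_word_linear lift_word_linear !lift_graded_bracket.
rewrite graded_word_linear lift_word_linear /derived_word.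
have [[lmu _] [ly _]] := (cochain_mu rho, cochain_graded y).
by rewrite word_bracket_linearr // word_bracket_linearl // scalerDr (scaler_swap c).
Qed.

Lemma graded_bracket_linearr m n (x : graded_hom g V m) :
  linear (fun y : graded_hom g V n => br x y).
Proof.
move=> c y y'; case: m x => [|m] x.
  by case: n y y' => [|n] y y'; rewrite /= scaler0 addr0.
case: n y y' => [|n] y y'; first by rewrite /= scaler0 addr0.
apply/graded_word_inj/lift_word_inj.
rewrite graded_word_linear lift_word_linear !lift_graded_bracket.
rewrite graded_word_linear lift_word_linear /derived_word.
have [cmu cx] := (cochain_mu rho, cochain_graded x).
have [ld _] := cochain_d cmu cx.
by rewrite word_bracket_linearr // scalerDr (scaler_swap c).
Qed.

Lemma graded_bracket0l m n (y : graded_hom g V n) : br (0 : graded_hom g V m) y = 0.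
Proof. exact: linear_map0 (@graded_bracket_linearl m n y). Qed.

Lemma graded_bracket0r m n (x : graded_hom g V m) : br x (0 : graded_hom g V n) = 0.
Proof. exact: linear_map0 (@graded_bracket_linearr m n x). Qed.

Lemma graded_bracket_skew m n (x : graded_hom g V m) (y : graded_hom g V n) :
  br x y = - ((-1) ^+ (m * n) *:
    degcast (L := fun k => graded_hom g V k) (addnC n m) (br y x)).
Proof.
apply/graded_word_inj; rewrite graded_wordN graded_wordZ graded_word_degcast.
case: m x => [|m] x.
  rewrite (graded_hom0 x) graded_bracket0l graded_bracket0r.
  by rewrite !graded_word0 scaler0 oppr0.
case: n y => [|n] y.
  rewrite (graded_hom0 y) graded_bracket0l graded_bracket0r.
  by rewrite !graded_word0 scaler0 oppr0.
apply: lift_word_inj; rewrite lift_wordN lift_wordZ !lift_graded_bracket.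
apply: derived_wordC; try exact: cochain_graded; last exact: bracket_lift0.
exact: cochain_mu.
Qed.

Lemma graded_bracket_jacobi m n p (nz2 : (2 : F) != 0)
    (x : graded_hom g V m) (y : graded_hom g V n) (z : graded_hom g V p) :
  br x (br y z) =
  degcast (L := fun k => graded_hom g V k) (esym (addnA m n p)) (br (br x y) z)
  + (-1) ^+ (m * n) *:
    degcast (L := fun k => graded_hom g V k) (addnCA n m p) (br y (br x z)).
Proof.
apply/graded_word_inj; rewrite addrC graded_word_linear !graded_word_degcast addrC.
case: m x => [|m] x.
  rewrite (graded_hom0 x) !graded_bracket0l graded_bracket0r.
  by rewrite !graded_word0 scaler0 addr0.
case: n y => [|n] y.
  rewrite (graded_hom0 y) ?(graded_bracket0l, graded_bracket0r).
  by rewrite !graded_word0 scaler0 addr0.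
case: p z => [|p] z.
  by rewrite (graded_hom0 z) !graded_bracket0r !graded_word0 scaler0 addr0.
apply: lift_word_inj; rewrite lift_wordD lift_wordZ.
(* [j.+1 + k.+1] computes to [(j + k.+1).+1], so the inner bracket has successor degree by
   conversion; on words, [addnS] adjusts a mere number. *)
have E i j k (a : graded_hom g V i.+1) (b : graded_hom g V j.+1)
    (c : graded_hom g V k.+1) :
  lift_word (graded_word (br a (br b c))) =
  derived_word mu i (j + k).+1 (lift_word (graded_word a))
    (derived_word mu j k (lift_word (graded_word b)) (lift_word (graded_word c))).
  rewrite -lift_graded_bracket -addnS.
  exact: (@lift_graded_bracket i (j + k.+1)).
have E' i j k (a : graded_hom g V i.+1) (b : graded_hom g V j.+1)
    (c : graded_hom g V k.+1) :
  lift_word (graded_word (br (br a b) c)) =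
  derived_word mu (i + j).+1 k
    (derived_word mu i j (lift_word (graded_word a)) (lift_word (graded_word b)))
    (lift_word (graded_word c)).
  rewrite -lift_graded_bracket -addnS.
  exact: (@lift_graded_bracket (i + j.+1)).
rewrite !E E'; exact: (derived_word_jacobi (cochain_mu rho) (mu_mu rho) nz2
  (cochain_graded x) (cochain_graded y) (cochain_graded z) (bracket_lift0 x y)).
Qed.

End DerivedBracketTheorem.

(** * The explicit formula and Maurer-Cartan elements *)

Section ExplicitFormula.
Variables (F : fieldType) (g : lieAlgType F) (V : lmodType F) (rho : lieRep g V).

Lemma anchor_rcons (f : seq V -> g) u y : anchor rho f (rcons u y) = rho (f u) y.
Proof. by case: u => [|x u] //=; rewrite belast_rcons last_rcons. Qed.

Lemma insertion_anchor p q N (f : multilin p.+1 V g) (h : multilin q.+1 V g)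
    (v : 'I_N.+1 -> V) : (p + q.+1)%N = N ->
  insertion q.+2 (anchor rho (word_fun h)) (word_fun f) (codom v) =
  \sum_(k < p.+1) \sum_(s in shuffles k q.+1)
    ((-1) ^+ (k * q.+1) * (-1) ^+ s) *:
      f (fun j : 'I_p.+1 =>
        if (j < k)%N then v (inord (perm_nat s j))
        else if j == k then
          rho (h (fun l : 'I_q.+1 => v (inord (perm_nat s (k + l)))))
              (v (inord (k + q.+1)))
        else v (inord (j + q.+1))).
Proof.
move=> pqN; rewrite insertion_perm; last by rewrite size_codom card_ord pqN.
apply: eq_bigr => k _; have kp := ltn_ord k.
apply: eq_bigr => s _; congr (_ *: multilin_fun f _); apply/funext => j.
have jp := ltn_ord j.
case: ltnP => jk; first by rewrite nth_codom //; apply: perm_nat_lt_le; lia.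
case: eqP => _; last by rewrite nth_codom //; lia.
rewrite anchor_rcons nth_codom; last by lia.
congr (rho _ _); rewrite /word_fun size_map size_iota eqxx.
congr (multilin_fun h _); apply/funext => l; have lq := ltn_ord l.
rewrite (nth_map 0%N) ?size_iota // nth_iota // nth_codom //.
by apply: perm_nat_lt_le; lia.
Qed.

Lemma shuffle_bracket_perm m n N (f : multilin m.+1 V g) (h : multilin n.+1 V g)
    (v : 'I_N.+1 -> V) : (m + n.+1)%N = N ->
  shuffle_bracket m.+1 n.+1 (word_fun f) (word_fun h) (codom v) =
  \sum_(s in shuffles m.+1 n.+1) ((-1) ^+ (m.+1 * n.+1) * (-1) ^+ s) *:
    lieb (f (fun j : 'I_m.+1 => v (inord (perm_nat s j))))
         (h (fun l : 'I_n.+1 => v (inord (perm_nat s (m.+1 + l))))).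
Proof.
move=> mnN; have vN : size (codom v) = (m.+1 + n.+1)%N.
  by rewrite size_codom card_ord -mnN addSn.
rewrite /shuffle_bracket shuffle_sum_perm; last by rewrite vN.
apply: eq_bigr => s _; congr (_ *: _).
rewrite drop_oversize; last by rewrite vN.
rewrite /word_fun !size_map !size_iota !eqxx.
congr (lieb (multilin_fun f _) (multilin_fun h _));
  apply/funext => j; have jm := ltn_ord j;
  rewrite (nth_map 0%N) ?size_iota // nth_iota // ?add0n nth_codom //;
  by apply: perm_nat_lt_le; lia.
Qed.

Lemma derived_bracket_formula m n (f : multilin m.+1 V g) (h : multilin n.+1 V g)
    (v : 'I_(m + n.+1).+1 -> V) :
  (derived_bracket rho f h : multilin (m + n.+1).+1 V g) v =
  (-1) ^+ (m.+1 * n.+1) *: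
    insertion m.+2 (anchor rho (word_fun f)) (word_fun h) (codom v)
  - insertion n.+2 (anchor rho (word_fun h)) (word_fun f) (codom v)
  - shuffle_bracket m.+1 n.+1 (word_fun f) (word_fun h) (codom v).
Proof. by rewrite -word_fun_codom word_fun_derived_bracket. Qed.

Lemma maurer_cartanP (nz2 : (2 : F) != 0) (T : multilin 1 V g) :
  maurer_cartan (graded_derived_bracket rho) T <->
  embedding_tensor rho (linear_of_multilin1 T).
Proof.
set t := linear_of_multilin1 T.
have T1 x : word_fun T [:: x] = t x.
  by rewrite /word_fun /=; congr (multilin_fun T _); apply/funext => i; rewrite ord1.
(* The two sums involving $\rho$ both give $-T(\rho(Tu)v)$, and the two $(1,1)$-shuffles both give
   $[Tu,Tv]$ by skew-symmetry. *)
have formula u v : derived_formula rho 0 0 (word_fun T) (word_fun T) [:: u; v] =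
    2 *: (lieb (t u) (t v) - t (rho (t u) v)).
  pose c := insertion 2 (anchor rho (word_fun T)) (word_fun T) [:: u; v].
  have cE : c = t (rho (t u) v).
    by rewrite /c /= /contract /= !scaler0 !add0r !T1 scaler0 add0r.
  rewrite -[LHS]/((-1) ^+ (1 * 1) *: c - c
    - shuffle_bracket 1 1 (word_fun T) (word_fun T) [:: u; v]) cE.
  rewrite /shuffle_bracket /= !T1 ?(expr0, expr1, scale1r, scaleN1r, addr0, add0r).
  rewrite (liebC (t v)) scaler_nat mulr2n; zmod.
have E := word_fun_derived_bracket rho T T.
split=> [TT u v|TT].
  rewrite (_ : derived_bracket rho T T = 0) in E; last exact: TT.
  have /eqP := formula u v; rewrite -E eq_sym [X in _ == X]/word_fun /=.
  by rewrite scaler_eq0 (negbTE nz2) subr_eq0 => /eqP.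
apply: (@word_fun_inj _ _ _ 1); rewrite E; apply/funext => w.
rewrite [RHS](_ : _ = 0); last by rewrite /word_fun; case: ifP.
have [w2|w2] := eqVneq (size w) 2; last first.
  by rewrite -E word_fun_supp.
case: w w2 => [|u [|v [|]]] // _.
by rewrite formula TT subrr scaler0.
Qed.

End ExplicitFormula.

Theorem theorem3p4 (F : fieldType) (charF0 : [pchar F] =i pred0)
    (g : lieAlgType F) (V : lmodType F) (rho : lieRep g V) :
  [/\ (* [[theta, phi]] = (-1)^(m-1) [[mu + rho, theta]_B, phi]_B *)
      forall (m n : nat) (theta : multilin m.+1 V g) (phi : multilin n.+1 V g),
        lift_hom (derived_bracket rho theta phi) =
        degcast (L := fun k => multilin k.+1 (g * V)%type (g * V)%type)
          (derived_degree m n)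
          ((-1) ^+ m *:
            balavoine (balavoine (mu_rho rho) (lift_hom theta)) (lift_hom phi)),
      graded_lie_algebra (graded_derived_bracket rho),
      forall (m n : nat) (theta : multilin m.+1 V g) (phi : multilin n.+1 V g)
             (v : 'I_(m.+1 + n.+1) -> V),
        derived_bracket rho theta phi v =
          \sum_(k < m.+1) \sum_(s in shuffles k n.+1)
            ((-1) ^+ (k * n.+1 + 1) * (-1) ^+ s) *:
              theta (fun j : 'I_m.+1 =>
                if (j < k)%N then v (inord (perm_nat s j))
                else if j == k then
                  rho (phi (fun l : 'I_n.+1 => v (inord (perm_nat s (k + l)))))
                      (v (inord (k + n.+1)))
                else v (inord (j + n.+1)))
        + \sum_(s in shuffles m.+1 n.+1)
            ((-1) ^+ (m.+1 * n.+1 + 1) * (-1) ^+ s) *: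
              lieb (theta (fun j : 'I_m.+1 => v (inord (perm_nat s j))))
                   (phi (fun l : 'I_n.+1 => v (inord (perm_nat s (m.+1 + l)))))
        + \sum_(k < n.+1) \sum_(s in shuffles k m.+1)
            ((-1) ^+ (m.+1 * (k + n.+1)) * (-1) ^+ s) *:
              phi (fun j : 'I_n.+1 =>
                if (j < k)%N then v (inord (perm_nat s j))
                else if j == k then
                  rho (theta (fun l : 'I_m.+1 => v (inord (perm_nat s (k + l)))))
                      (v (inord (k + m.+1)))
                else v (inord (j + m.+1)))
    & (* graded_hom g V 1 is Hom(V, g) *)
      forall T : multilin 1 V g,
        maurer_cartan (graded_derived_bracket rho) T <->
        embedding_tensor rho (linear_of_multilin1 T)].
Proof.
have nz2 : (2 : F) != 0.
  by have := charF0 2%N; rewrite !inE /= => /negbT.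
split.
- move=> m n f h; apply: word_fun_inj.
  by rewrite word_fun_lift_hom lift_derived_bracket -word_fun_derived_cochain.
- split.
  + exact: graded_bracket_linearl.
  + exact: graded_bracket_linearr.
  + exact: graded_bracket_skew.
  + by move=> m n p x y z; exact: graded_bracket_jacobi.
- move=> m n f h v; rewrite [LHS](derived_bracket_formula rho f h v).
  rewrite (insertion_anchor rho f h) // (insertion_anchor rho h f); last first.
    by rewrite !addnS addnC.
  rewrite (shuffle_bracket_perm f h) // -addrA addrC; congr (_ + _ + _).
  + rewrite -sumrN; apply: eq_bigr => k _; rewrite -sumrN; apply: eq_bigr => s _.
    by rewrite -scaleNr exprD expr1 mulrN1 mulNr.
  + rewrite -sumrN; apply: eq_bigr => s _.
    by rewrite -scaleNr exprD expr1 mulrN1 mulNr.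
  + rewrite scaler_sumr; apply: eq_bigr => k _; rewrite scaler_sumr.
    apply: eq_bigr => s _; rewrite scalerA mulrA -exprD.
    by have -> : (m.+1 * n.+1 + k * m.+1 = m.+1 * (k + n.+1))%N by lia.
- exact: maurer_cartanP.
Qed.
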